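(* Let $(\mathbf{X}_t)$ be a geometric opinion dynamics (as in the context), and suppose there exists an invariant distribution $\mu^*$ with $\mu^*(P^c)>0$. Then there exists a starting configuration $\mathbf{X}_0\in(\mathbb{S}^{d-1})^n$ from which $\mathbf{X}_t$ does not weakly polarize on average. In particular, if the dynamics are continuous (for every fixed $\xi$ and every $i$, $f_i(\cdot,\xi)$ is continuous on $(\mathbb{S}^{d-1})^n$), then the dynamics weakly polarize on average from every starting configuration if and only if every invariant distribution is supported on $P$.
   Context: Fix $n,d\ge1$. A geometric opinion dynamics is the Markov chain $\mathbf{X}_t=(\mathbf{X}_t^{(1)},\ldots,\mathbf{X}_t^{(n)})$ on $(\mathbb{S}^{d-1})^n$ given by $\mathbf{X}_{t+1}^{(i)}=P_{\mathbb{S}^{d-1}}\big(\mathbf{X}_t^{(i)}+f_i(\mathbf{X}_t^{(1)},\ldots,\mathbf{X}_t^{(n)},\xi_t)\big)$, with $P_{\mathbb{S}^{d-1}}(\mathbf{x})=\mathbf{x}/\|\mathbf{x}\|_2$, $\xi_t\in\mathbb{S}^{d-1}$ i.i.d. from a fixed distribution $\mathcal{D}$ independent of everything else, each $f_i:(\mathbb{S}^{d-1})^{n+1}\to\mathbb{R}^d$ a fixed measurable function, and the unnormalized vector assumed always nonzero. An invariant distribution is a probability measure $\mu$ on $(\mathbb{S}^{d-1})^n$ such that $\mathbf{X}_0\sim\mu$ implies $\mathbf{X}_1\sim\mu$. $P=\{(\sigma_1\mathbf{x},\ldots,\sigma_n\mathbf{x}):\mathbf{x}\in\mathbb{S}^{d-1},\bm{\sigma}\in\{-1,1\}^n\}$,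 $P^c$ its complement in $(\mathbb{S}^{d-1})^n$, $\rho(\mathbf{z},P)=\inf_{\mathbf{y}\in P}\|\mathbf{z}-\mathbf{y}\|_2$. The chain weakly polarizes on average from $\mathbf{X}_0$ if for every $\epsilon>0$, $\lim_{T\to\infty}\frac1T\mathbb{E}[\sum_{t=1}^T I_{P_\epsilon}(\mathbf{X}_t)]=1$, where $P_\epsilon=\{\mathbf{z}:\rho(\mathbf{z},P)\le\epsilon\}$ and $I_{P_\epsilon}$ is its indicator. *)

(* Defs.v *)
From HB Require Import structures.
From mathcomp Require Import all_boot all_order all_algebra.
From mathcomp Require Import all_classical all_reals all_analysis.
Set Implicit Arguments. Unset Strict Implicit. Unset Printing Implicit Defensive.
Import Order.TTheory GRing.Theory Num.Theory.
Import numFieldNormedType.Exports.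
Local Open Scope classical_set_scope.
Local Open Scope ring_scope.

Definition Borel (T : topologicalType) := g_sigma_algebraType (@open T).

Section GOD.
Variables (R : realType) (n d : nat).

Definition enorm (v : 'rV[R]_d) : R := Num.sqrt (\sum_(j < d) v 0 j ^+ 2).

Definition sph : set 'rV[R]_d := [set v | \sum_(j < d) v 0 j ^+ 2 = 1].

(* Configurations: row i of a n x d matrix is the opinion of agent i. *)
Definition sphn : set 'M[R]_(n, d) := [set x | forall i : 'I_n, sph (row i x)].

Definition proj_sph (v : 'rV[R]_d) : 'rV[R]_d := (enorm v)^-1 *: v.

Definition step (f : 'I_n -> 'M[R]_(n, d) -> 'rV[R]_d -> 'rV[R]_d)
  (x : 'M[R]_(n, d)) (xi : 'rV[R]_d) : 'M[R]_(n, d) :=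
  \matrix_(i < n, j < d) proj_sph (row i x + f i x xi) 0 j.

Definition edist (z y : 'M[R]_(n, d)) : R :=
  Num.sqrt (\sum_(i < n) \sum_(j < d) (z i j - y i j) ^+ 2).

Definition Ppol : set 'M[R]_(n, d) :=
  [set z | exists v, sph v /\ exists s : 'I_n -> bool,
      z = \matrix_(i < n, j < d) ((-1) ^+ s i * v 0 j)].

Definition rhoP (z : 'M[R]_(n, d)) : R := inf [set edist z y | y in Ppol].

Definition Peps (eps : R) : set 'M[R]_(n, d) := [set z | rhoP z <= eps].

(* t-step transition probabilities of the chain started at x:
   ptrans t x A = Prob(X_t in A | X_0 = x), computed by integrating out
   the i.i.d. noises xi_0, ..., xi_{t-1} ~ D one at a time. *)
Fixpoint ptrans (f : 'I_n -> 'M[R]_(n, d) -> 'rV[R]_d -> 'rV[R]_d)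
  (D : probability (Borel 'rV[R]_d) R) (t : nat) (x : 'M[R]_(n, d))
  (A : set 'M[R]_(n, d)) : \bar R :=
  match t with
  | 0 => (\1_A x)%:E
  | t'.+1 => (\int[D]_xi ptrans f D t' (step f x xi) A)%E
  end.

(* mu is an invariant distribution: a probability measure on (S^{d-1})^n
   (i.e. concentrated on sphn) such that X_0 ~ mu (independent of xi_0)
   implies X_1 ~ mu. *)
Definition invariant_distr f D (mu : probability (Borel 'M[R]_(n, d)) R) : Prop :=
  mu sphn = 1%E /\
  forall A : set (Borel 'M[R]_(n, d)), measurable A ->
    (\int[mu]_x ptrans f D 1 x A)%E = mu A.

(* Weak polarization on average from x0:
   for every eps > 0, (1/T) E[sum_{t=1}^T 1_{P_eps}(X_t)] -> 1. *)
Definition weakly_polarizes_on_average f D (x0 : 'M[R]_(n, d)) : Prop :=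
  forall eps : R, 0 < eps ->
    (fun T : nat => (T.+1%:R)^-1 *
        \sum_(t < T.+1) fine (ptrans f D t.+1 x0 (Peps eps)))
      @ \oo --> (1 : R).

End GOD.

(* Main.v *)
(* Writing X_{t+1} = S(X_t, xi_t), let T nu be the law of S(X, xi) for independent
   X ~ nu and xi ~ D.  If mu is invariant and every starting point polarizes,
   integrating the Cesaro averages of P(X_t in P_eps | X_0 = x) against mu gives
   mu(P_eps) for every N, while dominated convergence sends them to 1; letting
   eps decrease to 0 yields mu(P) = 1, as P is closed.  Conversely, if some
   starting point does not polarize, the averages are at most 1 - e along
   a proper filter of times; the limit of the averaged laws along a finer ultrafilter is a
   finitely additive content, which compactness of the sphere product regularizes
   into a probability measure mu.  For continuous dynamics mu is invariant
   (Krylov-Bogoliubov), and mu(rho < eps) <= 1 - e, so mu(P) < 1. *)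
Require Import Defs.
From HB Require Import structures.
From mathcomp Require Import all_boot all_order all_algebra.
From mathcomp Require Import all_classical all_reals all_analysis.
From mathcomp Require Import measurable_realfun simple_functions.
From mathcomp Require Import measurable_fun_approximation.
Import Order.TTheory GRing.Theory Num.Theory.
Import numFieldNormedType.Exports.
Local Open Scope classical_set_scope.
Local Open Scope ring_scope.
Set Implicit Arguments. Unset Strict Implicit. Unset Printing Implicit Defensive.

(** * Probability measures from contents *)

(** The limit of the laws along an ultrafilter need not be countably additive: for Dirac masses at
    points [x_k] converging to [x] but different from it, the limit gives the point [x] itself no
    mass. Regularization moves that mass back, so what it keeps of the content [m] is the one-sided
    bound [mu U <= m U] on open sets. This bound is used twice. Applied to the superlevel sets of a
    continuous [h], and then of [1 - h], it gives convergence of integrals, hence invariance. It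
    also carries the bound [1 - e] to the set where [rhoP] is strictly below [eps], which is open
    and still contains P. A second obstacle is that [f] is measurable, and later continuous, only on
    the spheres. The update map is therefore extended, continuity is taken within a compact set [K],
    and sets and integrals are compared through their traces on [K], which has full measure for the
    laws involved. *)

Section borel_sets.
Context {R : realType} {X : pseudoPMetricType R}.

Lemma open_Borel_measurable (U : set X) : open U -> measurable (U : set (Borel X)).
Proof. by move=> oU; exact: sub_sigma_algebra. Qed.

Lemma closed_Borel_measurable (C : set X) :
  closed C -> measurable (C : set (Borel X)).
Proof.
move=> cC; rewrite -[C]setCK; apply: measurableC.
by apply: open_Borel_measurable; exact: closed_openC.
Qed.

(** Closed sets exhausting an open [U]. For abstract balls the inner set need not be closed; taking
    its closure costs half of the radius, see [shrink_ball]. *)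
Definition shrink (U : set X) (k : nat) : set X :=
  closure [set x | ball x k.+1%:R^-1 `<=` U].

Lemma shrink_ball (U : set X) k x : shrink U k x ->
  ball x (k.+1%:R^-1 / 2) `<=` U.
Proof.
move=> /(_ (ball x (k.+1%:R^-1 / 2))) [|y [yU xy] z xz].
  by apply: nbhsx_ballx; rewrite divr_gt0.
apply: yU; rewrite (splitr k.+1%:R^-1); apply: ball_triangle xz.
exact: ball_sym.
Qed.

Lemma shrink_sub (U : set X) k : shrink U k `<=` U.
Proof. by move=> x /shrink_ball; apply; apply: ballxx; rewrite divr_gt0. Qed.

Lemma closed_shrink (U : set X) k : closed (shrink U k).
Proof. exact: closed_closure. Qed.

Lemma shrink_nondecreasing (U : set X) : nondecreasing_seq (shrink U).
Proof.
move=> k l kl; rewrite subsetEset; apply: closureS => x /=; apply: subset_trans.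
by apply: le_ball; rewrite lef_pV2 ?posrE// ler_nat ltnS.
Qed.

(** Point and index vary jointly because [inner_bigcup] uses compactness in its near-covering form,
    with the index tending to infinity. *)
Lemma near_shrink (U : set X) x : open U -> U x ->
  \forall y \near x & k \near \oo, shrink U k y.
Proof.
rewrite openE => oU /oU /nbhs_ballP[e /= e0 eU].
have e20 : 0 < e / 2 by rewrite divr_gt0.
exists (ball x (e / 2), [set k | k.+1%:R^-1 < e / 2]).
  split; first exact: nbhsx_ballx.
  exact: (near_infty_natSinv_lt (PosNum e20)).
move=> [y k] [/= xy ke]; apply: subset_closure => z /= yz; apply: eU.
rewrite (splitr e); apply: ball_triangle xy _.
by apply: le_ball yz; exact: ltW.
Qed.

Lemma bigcup_shrink (U : set X) : open U -> \bigcup_k shrink U k = U.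
Proof.
move=> oU; apply/seteqP; split=> [x [k _] /shrink_sub //|x Ux].
have [[P Q] [/= xP [n _ nQ]] PQ] := near_shrink oU Ux.
exists n => //; apply: (PQ (x, n)); split => /=; first exact: nbhs_singleton.
by apply: nQ => /=.
Qed.

End borel_sets.

(** * Regularizing a finitely additive content into a measure *)

Section content_extension.
Context {R : realType} {X : pseudoPMetricType R}.
Variables (m : set X -> R) (K : set X).
Hypothesis m_ge0 : forall A : set (Borel X), measurable A -> 0 <= m A.
Hypothesis mU : forall A B : set (Borel X), measurable A -> measurable B ->
  A `&` B = set0 -> m (A `|` B) = m A + m B.
Hypothesis mT : m setT = 1.
Hypothesis compactK : compact K.
Hypothesis closedK : closed K.
Hypothesis mK : m (~` K) = 0.

Let le_m (A B : set (Borel X)) : measurable A -> measurable B ->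
  A `<=` B -> m A <= m B.
Proof.
move=> mA mB AB; rewrite -(setDUK AB) mU//; last 2 first.
- exact: measurableD.
- by rewrite setDIK.
by rewrite lerDl m_ge0//; exact: measurableD.
Qed.

Let m0 : m set0 = 0.
Proof.
have := @mU set0 set0 measurable0 measurable0 (set0I _).
by rewrite setU0 => /eqP; rewrite addrC -subr_eq subrr => /eqP.
Qed.

Let m_subU (A B : set (Borel X)) : measurable A -> measurable B ->
  m (A `|` B) <= m A + m B.
Proof.
move=> mA mB; have mBA : measurable (B `\` A : set (Borel X)) by exact: measurableD.
have -> : A `|` B = A `|` (B `\` A).
  apply/seteqP; split=> x [Ax|]; [by left| |by left|by case; right].
  by have [Ax|nAx] := pselect (A x); [left|right].
by rewrite mU ?setDIK// lerD2l le_m//; exact: subDsetl.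
Qed.

Let m_bigsetU (F : nat -> set (Borel X)) N : (forall k, measurable (F k)) ->
  m (\big[setU/set0]_(k < N) F k) <= \sum_(k < N) m (F k).
Proof.
move=> mF; elim: N => [|N ih]; first by rewrite !big_ord0 m0.
rewrite !big_ord_recr/= (le_trans (m_subU _ _))//; last by rewrite lerD2r.
exact: bigsetU_measurable.
Qed.

Definition inner_content (U : set X) : \bar R :=
  ereal_sup [set (m C)%:E | C in [set C | closed C /\ C `<=` U]].

Definition outer_content (A : set X) : \bar R :=
  ereal_inf [set inner_content U | U in [set U | open U /\ A `<=` U]].

Let closed_le_inner C U : closed C -> C `<=` U -> ((m C)%:E <= inner_content U)%E.
Proof. by move=> cC CU; apply: ereal_sup_ubound; exists C. Qed.

Let inner_le_open U : open U -> (inner_content U <= (m U)%:E)%E.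
Proof.
move=> oU; apply: ge_ereal_sup => _ [C [cC CU] <-]; rewrite lee_fin le_m//.
- exact: closed_Borel_measurable.
- exact: open_Borel_measurable.
Qed.

Let inner_ge0 U : (0 <= inner_content U)%E.
Proof. by rewrite -[0%E]/(0%:E) -m0 closed_le_inner//; exact: closed0. Qed.

Let le_inner U V : U `<=` V -> (inner_content U <= inner_content V)%E.
Proof.
move=> UV; apply: ge_ereal_sup => _ [C [cC CU] <-].
by apply: closed_le_inner => //; exact: subset_trans UV.
Qed.

Let inner_le1 U : (inner_content U <= 1)%E.
Proof.
rewrite (le_trans (le_inner (@subsetT _ U)))//.
by rewrite (le_trans (inner_le_open openT))// mT.
Qed.

Let inner_fin U : inner_content U \is a fin_num.
Proof. by rewrite ge0_fin_numE// (le_lt_trans (inner_le1 U))// ltry. Qed.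

Let outer_open U : open U -> outer_content U = inner_content U.
Proof.
move=> oU; apply/eqP; rewrite eq_le; apply/andP; split.
  by apply: ereal_inf_lbound; exists U => //; split.
by apply: le_ereal_inf_tmp => _ [V [oV UV] <-]; exact: le_inner.
Qed.

Let outer0 : outer_content set0 = 0%E.
Proof.
rewrite outer_open; last exact: open0.
apply/eqP; rewrite eq_le inner_ge0 andbT.
by rewrite (le_trans (inner_le_open open0))// m0.
Qed.

Let outer_ge0 A : (0 <= outer_content A)%E.
Proof. by apply: le_ereal_inf_tmp => _ [U _ <-]. Qed.

Let le_outer : {homo outer_content : A B / A `<=` B >-> (A <= B)%E}.
Proof.
move=> A B AB; apply: le_ereal_inf_tmp => _ [U [oU BU] <-].
by apply: ereal_inf_lbound; exists U => //; split => //; exact: subset_trans BU.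
Qed.

Let outer_fin A : outer_content A \is a fin_num.
Proof.
rewrite ge0_fin_numE// (le_lt_trans (le_outer (@subsetT _ A)))//.
by rewrite outer_open; [rewrite (le_lt_trans (inner_le1 _))// ltry|exact: openT].
Qed.

(** The trace of a closed [C] on [K] is compact, so finitely many shrunken [U k] cover it, and
    finite subadditivity of [m] applies to these; the rest of [C] has content zero by [mK]. *)
Let inner_bigcup (U : (set X)^nat) : (forall k, open (U k)) ->
  (inner_content (\bigcup_k U k) <= \sum_(k <oo) inner_content (U k))%E.
Proof.
move=> oU; apply: ge_ereal_sup => _ [C [cC CU] <-].
have cCK : compact (C `&` K) by rewrite setIC; exact: compact_closedI.
(* [N] counts the sets kept and is also their shrinking index: [N >= k] keeps [U k], and [N >= n]
   puts the nearby points in its shrunken copy. *)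
move/compact_near_coveringP : cCK => /(_ nat \oo
  (fun N x => exists2 k, (k < N.+1)%N & shrink (U k) N x)) [].
  move=> x [Cx _]; have [k _ Ukx] := CU _ Cx.
  have [[P Q] [/= xP [n _ nQ]] PQ] := near_shrink (oU k) Ukx.
  exists (P, [set N | (maxn n k <= N)%N]); first by split => //; exists (maxn n k).
  move=> [y N] [/= Py]; rewrite geq_max => /andP[nN kN].
  by exists k => //; apply: (PQ (y, N)); split => //=; exact: nQ.
move=> N _ /(_ N (leqnn N)) CKN.
have mC := closed_Borel_measurable cC; have mKc := closed_Borel_measurable closedK.
have mS k : measurable (shrink (U k) N : set (Borel X)).
  by apply: closed_Borel_measurable; exact: closed_shrink.
apply: (@le_trans _ _ (\sum_(k < N.+1) inner_content (U k))%E); last first.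
  by rewrite -(big_mkord xpredT (fun k => inner_content (U k))); exact: nneseries_lim_ge.
apply: (@le_trans _ _ (\sum_(k < N.+1) m (shrink (U k) N))%:E); last first.
  rewrite -sumEFin; apply: lee_sum => k _.
  by apply: closed_le_inner; [exact: closed_shrink|exact: shrink_sub].
rewrite lee_fin (le_trans _ (@m_bigsetU (fun k => shrink (U k) N) N.+1 mS))//.
rewrite -[leRHS]addr0 -mK (le_trans _ (m_subU _ _))//.
- apply: le_m => //.
  + apply: measurableU; first exact: bigsetU_measurable.
    exact: measurableC.
  + move=> x Cx; have [Kx|] := pselect (K x); [left|by right].
    have [k kN Ux] := CKN x (conj Cx Kx).
    by rewrite -(bigcup_mkord _ (fun k => shrink (U k) N)); exists k.
- exact: bigsetU_measurable.
- exact: measurableC.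
Qed.

Let outer_sigma_subadditive : sigma_subadditive outer_content.
Proof.
move=> A; apply/lee_addgt0Pr => e e0.
rewrite (le_trans _ (epsilon_trick _ _ (ltW e0)))//.
have /choice[U HU] : forall k, exists U, [/\ open U, A k `<=` U &
    (inner_content U <= outer_content (A k) + (e / (2 ^ k.+1)%:R)%:E)%E].
  move=> k; have ek : 0 < e / (2 ^ k.+1)%:R :> R by rewrite divr_gt0// ltr0n expn_gt0.
  have [_ [U [oU AU] <-] /ltW UA] := lb_ereal_inf_adherent ek (outer_fin (A k)).
  by exists U.
have oU k : open (U k) by have [] := HU k.
apply: (@le_trans _ _ (outer_content (\bigcup_k U k))).
  apply: le_outer => x [k _ Akx]; exists k => //.
  by have [_ + _] := HU k; exact.
rewrite outer_open; last exact: bigcup_open.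
rewrite (le_trans (inner_bigcup oU))//.
by apply: lee_nneseries => // k _; have [] := HU k.
Qed.

HB.instance Definition _ := isOuterMeasure.Build R X outer_content
  outer0 outer_ge0 le_outer outer_sigma_subadditive.

(** [V] minus [U] need not be open, so it is enlarged to [V] minus [C], where the closed set [C]
    nearly exhausts [V] inside [U]. A closed [C'] in this open set is disjoint from [C], and [m] is
    additive on the two. *)
Let open_caratheodory U : open U -> outer_content.-caratheodory U.
Proof.
move=> oU; apply: le_caratheodory_measurable => A.
apply: le_ereal_inf_tmp => _ [V [oV AV] <-].
apply/lee_addgt0Pr => e e0; have e20 : 0 < e / 2 by rewrite divr_gt0.
have [_ [C [cC CVU] <-] HC] := ub_ereal_sup_adherent e20 (inner_fin (V `&` U)).
have [_ [C' [cC' CVC] <-] HC'] := ub_ereal_sup_adherent e20 (inner_fin (V `\` C)).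
have oVU : open (V `&` U) by exact: openI.
have oVC : open (V `\` C) by apply: openI => //; exact: closed_openC.
apply: (@le_trans _ _ (inner_content (V `&` U) + inner_content (V `\` C))%E).
  rewrite leeD//.
    by rewrite -outer_open//; apply: le_outer; exact: setSI.
  rewrite -outer_open//; apply: le_outer => x [Ax nUx]; split; first exact: AV.
  by move=> /CVU[].
apply: (@le_trans _ _ (((m C)%:E + (e / 2)%:E) + ((m C')%:E + (e / 2)%:E))%E).
  by rewrite leeD// -leeBlDr// ltW.
rewrite addeACA -!EFinD -splitr EFinD leeD2r//.
rewrite -mU; last 3 first.
- exact: closed_Borel_measurable.
- exact: closed_Borel_measurable.
- by apply/seteqP; split => // x [Cx /CVC[]].
apply: closed_le_inner; first exact: closedU.
by move=> x [/CVU[]|/CVC[]].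
Qed.

Let Borel_caratheodory (A : set (Borel X)) :
  measurable A -> outer_content.-caratheodory A.
Proof.
apply: smallest_sub => [|U oU]; last exact: open_caratheodory.
exact: (@sigma_algebra_measurable _ (caratheodory_type outer_content)).
Qed.

Let extension : set (Borel X) -> \bar R := outer_content.

Let extension_sigma_additive : semi_sigma_additive extension.
Proof.
move=> F mF tF mUF; apply: caratheodory_measure_sigma_additive => //.
- by move=> k; exact: Borel_caratheodory.
- exact: Borel_caratheodory.
Qed.

HB.instance Definition _ := isMeasure.Build _ _ _ extension
  outer0 outer_ge0 extension_sigma_additive.

Let extensionT : extension setT = 1%E.
Proof.
rewrite /extension outer_open; last exact: openT.
apply/eqP; rewrite eq_le inner_le1/= -mT.
by rewrite closed_le_inner//; exact: closedT.
Qed.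

HB.instance Definition _ := Measure_isProbability.Build _ _ _ extension extensionT.

(* Inner regularity over closed sets on open sets, then outer regularity over
   open sets, turns [m] into an outer measure; compactness of [K] makes the
   former countably subadditive, and open sets Caratheodory measurable. *)
Lemma content_probability : exists mu : probability (Borel X) R,
  mu K = 1%E /\ forall U, open U -> (mu U <= (m U)%:E)%E.
Proof.
exists extension; split; last first.
  by move=> U oU; rewrite /= /extension outer_open//; exact: inner_le_open.
have mKc := closed_Borel_measurable closedK.
have K1 : m K = 1.
  by rewrite -mT -(setvU K) mU ?mK ?add0r ?setICl//; exact: measurableC.
apply/eqP; rewrite eq_le probability_le1//= -K1.
by apply: le_ereal_inf_tmp => _ [U [oU KU] <-]; exact: closed_le_inner.
Qed.

End content_extension.

(** * Limits of probability measures along an ultrafilter *)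

(** Compactness of the unit interval gives a cluster point, and an ultrafilter converges to each of
    its cluster points, since it contains every set or its complement. *)
Lemma ultra_cvg_itv {R : realType} {I : Type} (U : set_system I) (f : I -> R) :
  UltraFilter U -> (forall i, 0 <= f i <= 1) -> f i @[i --> U] --> lim (f i @[i --> U]).
Proof.
move=> UU f01; have PU := @ultra_proper _ _ UU.
have UI : U (f @^-1` `[0, 1]%classic).
  by apply: filterE => i; rewrite /= in_itv; exact: f01.
have [p [_ clp]] := @segment_compact R 0 1 (f @ U) _ UI.
apply: cvgP (p) _ => B Bp.
have [//|UB] := in_ultra_setVsetC (f @^-1` B) UU.
by have [x []] := clp (~` B) B UB Bp.
Qed.

Section unit_valued.
Context {d} {T : measurableType d} {R : realType} (P : probability T R).
Implicit Type h : T -> R.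

(** Values in the unit interval make integrability automatic, and the class is stable under [1 - h],
    which turns upper bounds into lower bounds. *)
Definition test_fun h := measurable_fun setT h /\ forall x, 0 <= h x <= 1.

Lemma test_fun_integrable h : test_fun h -> P.-integrable setT (EFin \o h).
Proof.
move=> [mh h01]; apply: measurable_bounded_integrable => //.
  by rewrite (le_lt_trans (probability_le1 _ _))// ltry.
exists 1; split=> // x x1 y _ /=; have /andP[h0 h1] := h01 y.
by rewrite ger0_norm// (le_trans h1)// ltW.
Qed.

Lemma test_fun_indic (A : set T) : measurable A -> test_fun (\1_A : T -> R).
Proof.
move=> mA; split; first exact: measurable_indic.
by move=> x; rewrite indicE ler0n lern1 leq_b1.
Qed.

Lemma Rintegral_indic (A : set T) : measurable A ->
  \int[P]_x (\1_A x : R) = fine (P A).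
Proof. by move=> mA; rewrite /Rintegral integral_indic// setIT. Qed.

Lemma test_funC h : test_fun h -> test_fun (fun x => 1 - h x).
Proof.
move=> [mh h01]; split=> [|x]; last first.
  by have /andP[h0 h1] := h01 x; rewrite subr_ge0 h1 gerBl h0.
exact: measurable_funB.
Qed.

Lemma Rintegral_test_funC h : test_fun h ->
  \int[P]_x (1 - h x) = 1 - \int[P]_x h x.
Proof.
move=> th; rewrite RintegralB//; last exact: test_fun_integrable.
  rewrite Rintegral_cst// mul1r; congr (_ - _).
  exact: (congr1 fine (probability_setT P)).
have := @test_fun_integrable (cst 1); apply.
by split=> [|x]; [exact: measurable_cst|rewrite lexx ler01].
Qed.

Lemma Rintegral_test_fun01 h : test_fun h -> 0 <= \int[P]_x h x <= 1.
Proof.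
move=> th; have th0 g : test_fun g -> 0 <= \int[P]_x g x.
  by move=> [_ g01]; apply: Rintegral_ge0 => x _; have /andP[] := g01 x.
rewrite th0//= -subr_ge0 -Rintegral_test_funC// th0//.
exact: test_funC.
Qed.

Lemma Rintegral_sum N (f : nat -> T -> R) :
  (forall k, P.-integrable setT (EFin \o f k)) ->
  P.-integrable setT (EFin \o (fun x => \sum_(k < N) f k x)) /\
  \int[P]_x (\sum_(k < N) f k x) = \sum_(k < N) \int[P]_x f k x.
Proof.
move=> intf; elim: N => [|N [ih Eh]].
  split; first by under [X in EFin \o X]eq_fun do rewrite big_ord0; exact: integrable0.
  under eq_Rintegral do rewrite big_ord0.
  by rewrite big_ord0 Rintegral_cst// mul0r.
under [X in EFin \o X]eq_fun do rewrite big_ord_recr.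
under eq_Rintegral do rewrite big_ord_recr.
rewrite big_ord_recr/= -Eh RintegralD//; split=> //.
by have := integrableD measurableT ih (intf N); 
  apply: eq_integrable => // x _; rewrite /= EFinD.
Qed.

(* Telescoping [h = \sum_k (min h (k+1)/N - min h k/N)] squeezes [h] between two
   sums of indicators of its superlevel sets. *)
Lemma superlevel_bounds h N : test_fun h ->
  N.+1%:R^-1 * \sum_(k < N.+1) fine (P [set x | k.+1%:R / N.+1%:R < h x])
    <= \int[P]_x h x
    <= N.+1%:R^-1 * \sum_(k < N.+1) fine (P [set x | k%:R / N.+1%:R < h x]).
Proof.
move=> [mh h01]; have th : test_fun h by [].
pose A c : set T := [set x | c < h x].
have mA c : measurable (A c).
  rewrite -[A c]setTI; have -> : A c = h @^-1` `]c, +oo[%classic.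
    by apply/seteqP; split=> x /=; rewrite in_itv/= andbT.
  exact: mh.
pose r (k : nat) : R := k%:R / N.+1%:R.
have intA c : P.-integrable setT (EFin \o (\1_(A c) : T -> R)).
  by apply: test_fun_integrable; exact: test_fun_indic.
have hE x : h x = \sum_(k < N.+1) (Num.min (h x) (r k.+1) - Num.min (h x) (r k)).
  rewrite -(big_mkord xpredT (fun k => Num.min (h x) (r k.+1) - Num.min (h x) (r k))).
  have /andP[h0 h1] := h01 x.
  rewrite telescope_sumr// /r divff// mul0r.
  by rewrite (min_idPl h1) (min_idPr h0) subr0.
have rS k : r k.+1 = r k + N.+1%:R^-1 by rewrite /r -addn1 natrD mulrDl mul1r.
have N0 : 0 < N.+1%:R^-1 :> R by rewrite invr_gt0.
have sumI (c : nat -> R) :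
    P.-integrable setT
      (EFin \o (fun x => N.+1%:R^-1 * \sum_(k < N.+1) (\1_(A (c k)) x : R)))
    /\ \int[P]_x (N.+1%:R^-1 * \sum_(k < N.+1) (\1_(A (c k)) x : R)) =
       N.+1%:R^-1 * \sum_(k < N.+1) fine (P (A (c k))).
  have [iS ES] := @Rintegral_sum N.+1 (fun k => \1_(A (c k))) (fun k => intA (c k)).
  split; last first.
    rewrite RintegralZl//; congr (_ * _); rewrite ES.
    by apply: eq_bigr => k _; rewrite Rintegral_indic.
  have := integrableZl measurableT N.+1%:R^-1 iS.
  by apply: eq_integrable => // x _; rewrite /= EFinM.
have [i1 <-] := sumI (r \o S); have [i0 <-] := sumI r.
have ih := test_fun_integrable th.
apply/andP; split; apply: le_Rintegral => // x _;
  rewrite [h x]hE mulr_sumr; apply: ler_sum => k _; rewrite indicE.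
- have [xk|xk] := ltP (r k.+1) (h x).
    rewrite mem_set// mulr1 (min_idPr _) ?rS 1?addrC ?addKr//.
    by rewrite (le_trans _ (ltW xk))// rS lerDl ltW.
  rewrite memNset ?mulr0 => [|/=]; last by apply/negP; rewrite -leNgt.
  by rewrite subr_ge0 ge_min lexx.
- have [xk|xk] := ltP (r k) (h x).
    by rewrite mem_set// mulr1 lerBlDl -rS ge_min lexx orbT.
  rewrite memNset ?mulr0 => [|/=]; last by apply/negP; rewrite -leNgt.
  by rewrite lerBlDl addr0 ge_min lexx.
Qed.

End unit_valued.

(** Lets a set that is only relatively open in a full-measure [K] be traded for an open set with the
    same trace. *)
Lemma probability_full_eq {d} {T : measurableType d} {R : realType}
    (P : probability T R) (K A B : set T) :
  measurable K -> P K = 1%E -> measurable A -> measurable B ->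
  A `&` K = B `&` K -> P A = P B.
Proof.
move=> mK PK mA mB AB.
have PE E : measurable E -> P E = P (E `&` K).
  move=> mE; rewrite -[E in LHS](setDUK (@subIsetl _ E K)) measureU ?setDIK//.
  - rewrite [X in (_ + X)%E](_ : _ = 0%E) ?adde0//.
    apply: (@subset_measure0 _ _ _ _ _ (~` K)) => //.
    + by apply: measurableD => //; exact: measurableI.
    + exact: measurableC.
    + by move=> x [Ex nEK] Kx; apply: nEK.
    + by rewrite [LHS](probability_setC P mK) PK subee.
  - exact: measurableI.
  - by apply: measurableD => //; exact: measurableI.
by rewrite PE// AB -PE.
Qed.

(** * Weak limits of probability measures carried by a compact set *)

Section ultralimit.
Context {R : realType} {X : pseudoPMetricType R} {I : Type}.
Variables (U : set_system I) (nu : I -> probability (Borel X) R) (K : set X).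
Hypothesis UU : UltraFilter U.
Hypothesis compactK : compact K.
Hypothesis closedK : closed K.
Hypothesis nuK : forall i, nu i K = 1%E.

Let PU : ProperFilter U. Proof. exact: ultra_proper. Qed.

Let m (A : set (Borel X)) : R := lim (fine (nu i A) @[i --> U]).

Let nu01 i A : measurable A -> 0 <= fine (nu i A) <= 1.
Proof.
move=> mA; rewrite fine_ge0//= -lee_fin fineK ?fin_num_measure//.
exact: probability_le1.
Qed.

Let cvgm (A : set (Borel X)) : measurable A -> fine (nu i A) @[i --> U] --> m A.
Proof. by move=> mA; apply: ultra_cvg_itv => // i; exact: nu01. Qed.

Let m_ge0 (A : set (Borel X)) : measurable A -> 0 <= m A.
Proof.
move=> mA; apply: (cvgr_to_ge (cvgm mA)).
by apply: nearW => i; have /andP[] := nu01 i mA.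
Qed.

Let m_cst (A : set (Borel X)) c : measurable A -> (forall i, nu i A = c%:E) -> m A = c.
Proof.
move=> mA nuA; rewrite /m; under eq_fun do rewrite nuA/=.
by apply: cvg_lim; [exact: Rhausdorff|exact: cvg_cst].
Qed.

Let mU (A B : set (Borel X)) : measurable A -> measurable B ->
  A `&` B = set0 -> m (A `|` B) = m A + m B.
Proof.
move=> mA mB AB; apply: cvg_lim; first exact: Rhausdorff.
rewrite [X in X @ _ --> _](_ : _ = fun i => fine (nu i A) + fine (nu i B)).
  by apply: cvgD; exact: cvgm.
by apply/funext => i; rewrite measureU// fineD// fin_num_measure.
Qed.

Lemma ultralimit : exists mu : probability (Borel X) R, [/\ mu K = 1%E,
  forall h : Borel X -> R, test_fun h -> {within K, continuous (h : X -> R)} ->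
    \int[nu i]_x h x @[i --> U] --> \int[mu]_x h x &
  forall O c, open O -> (\forall i \near U, fine (nu i O) <= c) ->
    (mu O <= c%:E)%E].
Proof.
have mK := closed_Borel_measurable closedK.
have [|| mu [muK mu_le]] := @content_probability R X m K m_ge0 mU _ compactK closedK.
- by apply: m_cst => // i; rewrite probability_setT.
- apply: m_cst => [|i]; first exact: measurableC.
  by rewrite probability_setC// nuK subee.
exists mu; split=> //; last first.
  move=> O c oO nuO; apply: (le_trans (mu_le _ oO)); rewrite lee_fin.
  exact: (cvgr_to_le (cvgm (open_Borel_measurable oO))).
pose L h := lim (\int[nu i]_x h x @[i --> U]).
have cvgL h : test_fun h -> \int[nu i]_x h x @[i --> U] --> L h.
  by move=> th; apply: ultra_cvg_itv => i; exact: Rintegral_test_fun01.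
(* The upper bound suffices: applied to [1 - h] it is the reverse inequality. *)
suff upper (h : Borel X -> R) : test_fun h -> {within K, continuous (h : X -> R)} ->
    \int[mu]_x h x <= L h.
  move=> h th ch; rewrite (_ : \int[mu]_x h x = L h); first exact: cvgL.
  apply/eqP; rewrite eq_le upper//= -lerN2 -(lerD2l 1).
  rewrite -(Rintegral_test_funC mu th) (le_trans (upper _ (test_funC th) _))//.
    by move=> x; apply: continuousB; [exact: cst_continuous|exact: ch].
  rewrite le_eqVlt; apply/orP; left; apply/eqP.
  apply: cvg_lim; first exact: Rhausdorff.
  under eq_fun do rewrite (Rintegral_test_funC _ th).
  by apply: cvgB; [exact: cvg_cst|exact: cvgL].
move=> th ch.
pose S c : set (Borel X) := [set x | c < h x].
have mS c : measurable (S c).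
  rewrite -[S c]setTI; have -> : S c = h @^-1` `]c, +oo[%classic.
    by apply/seteqP; split=> x /=; rewrite in_itv/= andbT.
  by case: th => + _; exact.
have mu_leS c : fine (mu (S c)) <= m (S c).
  have /open_subspaceP[V oV VS] : open (S c : set (subspace K)).
    have -> : S c = h @^-1` `]c, +oo[%classic.
      by apply/seteqP; split=> x /=; rewrite in_itv/= andbT.
    by move/continuousP : ch; apply; exact: interval_open.
  have mV := open_Borel_measurable oV.
  have -> : m (S c) = m V.
    rewrite /m; under eq_fun do
      rewrite (@probability_full_eq _ _ _ (nu _) K _ V mK (nuK _) (mS c) mV (esym VS)).
    by [].
  rewrite -lee_fin fineK ?fin_num_measure// (@probability_full_eq _ _ _ mu K _ V)//.
  exact: mu_le.
apply/ler_addgt0Pr => e e0; near \oo => N.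
have [_ /le_trans] := andP (superlevel_bounds mu N th); apply.
pose r k : R := k%:R / N.+1%:R.
have N0 : 0 < N.+1%:R^-1 :> R by rewrite invr_gt0.
apply: (@le_trans _ _ (N.+1%:R^-1 * \sum_(k < N.+1) m (S (r k)))).
  by rewrite ler_pM2l//; apply: ler_sum => k _; exact: mu_leS.
rewrite -lerBlDr.
rewrite -subr_le0; set Bm := _ * _.
(* [Bm] and [L h] are limits along [U], so the comparison is proved for each [nu i] and then passed
   to the limit. *)
have cvg_diff : N.+1%:R^-1 * (\sum_(k < N.+1) fine (nu i (S (r k)))) - e - \int[nu i]_x h x
    @[i --> U] --> Bm - e - L h.
  apply: cvgB (cvgL _ th); apply: cvgB; last exact: cvg_cst.
  apply: cvgM; first exact: cvg_cst.
  by apply: (cvg_big (@add_continuous _)) => k _; exact: cvgm.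
apply: (cvgr_to_le cvg_diff).
apply: nearW => i; rewrite subr_le0.
have [/(le_trans _) + _] := andP (superlevel_bounds (nu i) N th); apply.
(* The upper sum exceeds the lower one by at most its term [k = 0], worth at most [1/(N+1) < e]; the
   other terms match after a shift of the index. *)
rewrite lerBlDr big_ord_recl mulrDr [leRHS]addrC lerD//.
    apply: (@le_trans _ _ N.+1%:R^-1); last first.
      by apply: ltW; near: N; exact: (near_infty_natSinv_lt (PosNum e0)).
    by rewrite ler_piMr ?(ltW N0)//; have /andP[] := nu01 i (mS (r 0%N)).
  rewrite ler_pM2l// big_ord_recr/= lerDl.
  by have /andP[] := nu01 i (mS (r N.+1)).
Unshelve. all: by end_near. Qed.

End ultralimit.

(** * Continuous functions determine Borel probability measures *)

Section borel_functions.
Context {R : realType} {X : pseudoPMetricType R}.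

Lemma continuous_Borel_measurable (h : X -> R) :
  continuous h -> measurable_fun setT (h : Borel X -> R).
Proof.
move=> ch; apply: (measurability _ (RGenOpens.measurableE R)).
move=> _ [_ [a [b ->] <-]]; rewrite setTI; apply: open_Borel_measurable.
by move/continuousP : ch; apply; exact: interval_open.
Qed.

(** The half radius left by [shrink_ball] is a uniform gap between the two sets, as a Urysohn
    function requires. *)
Lemma continuous_test_fun_separation (O : set X) k : open O ->
  exists h : Borel X -> R, [/\ continuous (h : X -> R), test_fun h,
    forall x, shrink O k x -> h x = 1 & forall x, ~ O x -> h x = 0].
Proof.
move=> oO; pose r : R := k.+1%:R^-1 / 2; have r0 : 0 < r by rewrite divr_gt0.
have sep : uniform_separator (~` O) (shrink O k).
  apply: uniform_separatorW; exists [set xy | ball xy.1 r xy.2].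
    by rewrite -entourage_ballE; exists r.
  rewrite -subset0 => -[x y] /= [[nOx Oy] xy]; apply: nOx.
  by apply: (shrink_ball Oy); exact: ball_sym.
pose h : X -> R := Urysohn (~` O) (shrink O k).
have ch : continuous h by exact: Urysohn_continuous.
exists h; split=> //.
- split; first exact: continuous_Borel_measurable.
  by move=> x; have := @Urysohn_range _ R _ _ (h x) (imageT _ x); rewrite /= in_itv.
- by move=> x Ox; apply: (Urysohn_sub1 sep); exists x.
- by move=> x Ox; apply: (Urysohn_sub0 sep); exists x.
Qed.

(** A Urysohn function squeezed between the indicators of [shrink O k] and [O] compares the measures
    on open sets, which form a generating pi-system. *)
Lemma probability_eq_continuous (P Q : probability (Borel X) R) :
  (forall h : Borel X -> R, continuous (h : X -> R) -> test_fun h ->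
    \int[P]_x h x = \int[Q]_x h x) ->
  forall A : set (Borel X), measurable A -> P A = Q A.
Proof.
move=> PQ; have le_open (P1 P2 : probability (Borel X) R) :
    (forall h : Borel X -> R, continuous (h : X -> R) -> test_fun h ->
      \int[P1]_x h x = \int[P2]_x h x) ->
    forall O, open O -> (P1 O <= P2 O)%E.
  move=> P12 O oO.
  have mS k : measurable (shrink O k : set (Borel X)).
    by apply: closed_Borel_measurable; exact: closed_shrink.
  have mO := open_Borel_measurable oO.
  have := @nondecreasing_cvg_mu _ _ _ P1 (shrink O) mS.
  rewrite bigcup_shrink// => /(_ mO (@shrink_nondecreasing _ _ O)) cvgP1.
  apply: (cvge_to_le cvgP1); apply: nearW => k /=.
  have [h [ch th h1 h0]] := @continuous_test_fun_separation O k oO.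
  rewrite -(fineK (fin_num_measure P1 _ (mS k))) -(fineK (fin_num_measure P2 _ mO)).
  rewrite lee_fin -!Rintegral_indic// (@le_trans _ _ (\int[P1]_x h x))//.
    apply: le_Rintegral => //; [|exact: test_fun_integrable|].
      by apply: test_fun_integrable; exact: test_fun_indic.
    move=> x _; rewrite indicE; case: (asboolP (shrink O k x)) => Sx.
      by rewrite mem_set// h1.
    by rewrite memNset//; have /andP[] := th.2 x.
  rewrite P12//; apply: le_Rintegral => //; [exact: test_fun_integrable| |].
    by apply: test_fun_integrable; exact: test_fun_indic.
  move=> x _; rewrite indicE; case: (asboolP (O x)) => Ox.
    by rewrite mem_set//; have /andP[] := th.2 x.
  by rewrite memNset// h0.
move=> A mA; apply: (@measure_unique _ R (Borel X) (@open X) (fun=> setT) _ _ _ _ P Q) => //.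
- by move=> U V; exact: openI.
- by move=> _; exact: openT.
- by rewrite bigcup_const.
- move=> O oO; apply/eqP; rewrite eq_le !le_open// => h ch th.
  by rewrite PQ.
- by move=> _; rewrite -ge0_fin_numE// fin_num_measure.
Qed.

(** Reduces continuity to sequences, the form in which dominated convergence applies; balls of
    radius [1/(k+1)] supply a countable base. *)
Lemma within_continuous_seq (f : X -> R) (K : set X) :
  (forall x (u : nat -> X), K x -> (forall k, K (u k)) -> u @ \oo --> x ->
    f (u k) @[k --> \oo] --> f x) ->
  {within K, continuous f}.
Proof.
move=> fu; apply/subspace_continuousP => x Kx.
apply/cvgrPdist_lt => e e0; apply: contrapT => nfe.
have /choice[u Hu] : forall k, exists y,
    [/\ ball x k.+1%:R^-1 y, K y & ~ (`|f x - f y| < e)].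
  move=> k; apply: contrapT => nk; apply: nfe.
  near=> y; apply: contrapT => fy; apply: nk; exists y; split=> //.
  - near: y; apply: (@cvg_within _ (nbhs x)).
    by apply: nbhsx_ballx; rewrite invr_gt0.
  - by near: y; exact: withinT.
have ux : u @ \oo --> x.
  apply/cvg_ballP => d d0; near=> k.
  have [xu _ _] := Hu k; apply: le_ball xu; apply: ltW; near: k.
  exact: (near_infty_natSinv_lt (PosNum d0)).
have Ku k : K (u k) by have [] := Hu k.
have /cvgrPdist_lt /(_ e e0) [N _ /(_ N (leqnn N))/=] := fu x u Kx Ku ux.
by have [] := Hu N.
Unshelve. all: by end_near. Qed.

End borel_functions.

(** * Markov chains driven by i.i.d. noise *)

Section cesaro.
Context {d} {T : measurableType d} {R : realType}.
Variable nu : nat -> probability T R.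

Let weight N : {nonneg R} := (N.+1%:R^-1)%:nng.

(** The index is shifted so that every [N], including 0, gives a probability. *)
Definition cesaro N : set T -> \bar R := mscale (weight N) (msum nu N.+1).

HB.instance Definition _ N := Measure.on (cesaro N).

Let cesaroE N A : cesaro N A = (N.+1%:R^-1%:E * \sum_(k < N.+1) nu k A)%E.
Proof. by []. Qed.

Let cesaroT N : cesaro N setT = 1%E.
Proof.
rewrite cesaroE; under eq_bigr do rewrite probability_setT.
by rewrite sumEFin sumr_const card_ord -EFinM mulVf.
Qed.

HB.instance Definition _ N := Measure_isProbability.Build _ _ _ (cesaro N) (cesaroT N).

Lemma fine_cesaro N A : measurable A ->
  fine (cesaro N A) = N.+1%:R^-1 * \sum_(k < N.+1) fine (nu k A).
Proof.
move=> mA; rewrite cesaroE; under eq_bigr do rewrite -(fineK (fin_num_measure (nu _) _ mA)).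
by rewrite sumEFin.
Qed.

Lemma Rintegral_cesaro N h : test_fun h ->
  \int[cesaro N]_x h x = N.+1%:R^-1 * \sum_(k < N.+1) \int[nu k]_x h x.
Proof.
move=> th; have [mh h01] := th; rewrite /Rintegral.
have mEh : measurable_fun setT (EFin \o h) by exact/measurable_EFinP.
have h0 x : setT x -> (0 <= (EFin \o h) x)%E.
  by move=> _; rewrite lee_fin; have /andP[] := h01 x.
have -> : (\int[cesaro N]_x (h x)%:E =
    (weight N)%:num%:E * \int[msum nu N.+1]_x (h x)%:E)%E.
  exact: ge0_integral_mscale.
rewrite ge0_integral_measure_sum//.
under eq_bigr do
  rewrite -(fineK (integrable_fin_num measurableT (test_fun_integrable (nu _) th))).
by rewrite sumEFin.
Qed.

End cesaro.

Section markov_chain.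
Context {R : realType} {X : pseudoPMetricType R} {dY} {Y : measurableType dY}.
Variables (D : probability Y R) (S : {mfun (Borel X * Y)%type >-> Borel X}).

Definition evolve (nu : probability (Borel X) R) : probability (Borel X) R :=
  distribution (nu \x D)%E S.

(** The recursion of [ptrans] for an everywhere measurable update map; [ptransE] identifies the two
    on [sphn]. *)
Fixpoint transition (t : nat) (x : X) (A : set X) : \bar R :=
  match t with
  | 0 => (\1_A x)%:E
  | t'.+1 => (\int[D]_y transition t' (S (x, y)) A)%E
  end.

Lemma transition_ge0 t x A : (0 <= transition t x A)%E.
Proof.
elim: t x => [|t ih] x /=; first by rewrite lee_fin.
by apply: integral_ge0 => y _; exact: ih.
Qed.

Lemma measurable_transition t (A : set (Borel X)) : measurable A ->
  measurable_fun setT (fun x : Borel X => transition t x A).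
Proof.
move=> mA; elim: t => [|t ih] /=.
  by apply/measurable_EFinP; exact: measurable_indic.
apply: (@measurable_fun_fubini_tonelli_F _ _ (Borel X) Y R D
  (fun p => transition t (S p) A)) => [|p]; last exact: transition_ge0.
exact: (measurableT_comp ih (measurable_funP S)).
Qed.

Lemma integral_evolve (nu : probability (Borel X) R) (h : Borel X -> \bar R) :
  measurable_fun setT h -> (forall x, 0 <= h x)%E ->
  (\int[evolve nu]_x h x = \int[nu]_x \int[D]_y h (S (x, y)))%E.
Proof.
move=> mh h0; rewrite ge0_integral_pushforward// preimage_setT.
by rewrite fubini_tonelli1//=; exact: (measurableT_comp mh (measurable_funP S)).
Qed.

(** [transition] unfolds the first step of the chain, which replaces the initial law [nu] by
    [evolve nu]; the induction must therefore range over all [nu]. *)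
Lemma integral_transition (nu : probability (Borel X) R) t (A : set (Borel X)) :
  measurable A -> (\int[nu]_x transition t x A = iter t evolve nu A)%E.
Proof.
move=> mA; elim: t nu => [|t ih] nu.
  by rewrite /= integral_indic// setIT.
rewrite iterSr -ih integral_evolve//; first exact: measurable_transition.
by move=> x; exact: transition_ge0.
Qed.

(** Exhibits transition probabilities as values of a probability measure, so that finiteness,
    monotonicity and the bound 1 are inherited. *)
Lemma transition_iter_evolve t x (A : set (Borel X)) : measurable A ->
  transition t x A = iter t evolve (dirac (x : Borel X)) A.
Proof.
move=> mA; rewrite -integral_transition//.
rewrite integral_dirac//; last exact: measurable_transition.
by rewrite diracT mul1e.
Qed.

Variable K : set X.
Hypothesis compactK : compact K.
Hypothesis closedK : closed K.
Hypothesis SK : forall x y, K x -> K (S (x, y)).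
Hypothesis S_continuous : forall y, {within K, continuous (fun x : X => S (x, y) : X)}.

Lemma evolve_full (nu : probability (Borel X) R) : nu K = 1%E -> evolve nu K = 1%E.
Proof.
have mK := closed_Borel_measurable closedK.
move=> nuK; apply/eqP; rewrite eq_le probability_le1//=.
rewrite -[leLHS]mule1 -{1}nuK -(probability_setT D) -product_measure1E//.
apply: le_measure; rewrite ?inE.
- exact: measurableX.
- by rewrite -[X in measurable X]setTI; exact: measurable_funP.
- by move=> [x y] [Kx _]; exact: SK.
Qed.

(** The Markov operator on functions, dual to [evolve] by [Rintegral_evolve]. *)
Definition markov_op (h : X -> R) (x : X) : R := \int[D]_y h (S (x, y)).

Let test_fun_section (h : Borel X -> R) x : test_fun h ->
  test_fun (fun y => h (S (x, y))).
Proof.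
move=> [mh h01]; split=> [|y]; last exact: h01.
apply: (measurableT_comp mh).
exact: (measurableT_comp (measurable_funP S) (measurable_pair1 x)).
Qed.

Let EFin_markov_op (h : Borel X -> R) x : test_fun h ->
  (markov_op h x)%:E = (\int[D]_y (h (S (x, y)))%:E)%E.
Proof.
move=> th; rewrite fineK//.
exact/integrable_fin_num/test_fun_integrable/test_fun_section.
Qed.

Lemma test_fun_markov_op (h : Borel X -> R) : test_fun h ->
  test_fun (markov_op h : Borel X -> R).
Proof.
move=> th; split=> [|x]; last exact/Rintegral_test_fun01/test_fun_section.
apply/measurable_EFinP.
have -> : EFin \o markov_op h = fubini_F D (fun p => (h (S p))%:E).
  by apply/funext => x /=; exact: EFin_markov_op.
apply: (@measurable_fun_fubini_tonelli_F _ _ (Borel X) Y R D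
  (fun p => (h (S p))%:E)) => [|p].
  by apply/measurable_EFinP; exact: (measurableT_comp th.1 (measurable_funP S)).
by rewrite lee_fin; have /andP[] := th.2 (S p).
Qed.

Lemma Rintegral_evolve (nu : probability (Borel X) R) (h : Borel X -> R) :
  test_fun h -> \int[evolve nu]_x h x = \int[nu]_x markov_op h x.
Proof.
move=> th; rewrite /Rintegral integral_evolve//.
- by congr fine; apply: eq_integral => x _; rewrite -EFin_markov_op.
- by apply/measurable_EFinP; exact: th.1.
- by move=> x; rewrite lee_fin; have /andP[] := th.2 x.
Qed.

(** The Feller property: the integrand is continuous in [x] on [K] for each fixed [y] and is
    dominated by 1. The result holds only within [K], hence the form of the test functions in
    [ultralimit]. *)
Lemma markov_op_continuous (h : Borel X -> R) : continuous (h : X -> R) ->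
  test_fun h -> {within K, continuous (markov_op h)}.
Proof.
move=> ch th; apply: within_continuous_seq => x u Kx Ku ux.
apply: fine_cvg; rewrite -/(markov_op h x) EFin_markov_op//.
apply: (@dominated_cvg _ _ _ _ _ measurableT _ _ (cst 1%E)).
- by move=> k; apply/measurable_EFinP; have [] := test_fun_section (u k) th.
- move=> y _; apply: cvg_EFin; first by apply: nearW.
  apply: (@continuous_cvg nat X R \oo _ (fun k => S (u k, y)) h); first exact: ch.
  have /subspace_continuousP/(_ x Kx) Sx := @S_continuous y.
  apply: cvg_trans Sx => V /= SV.
  have SuV : \forall k \near \oo, K (u k) -> V (S (u k, y)) := ux _ SV.
  by apply: filterS SuV => k /(_ (Ku k)).
- by [].
- exact: (finite_measure_integrable_cst D 1).
- by move=> k y _ /=; rewrite lee_fin ger0_norm; have /andP[] := th.2 (S (u k, y)).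
Qed.

(* Krylov-Bogoliubov: a limit point of the Cesaro averages of the laws is
   invariant, because averages of consecutive laws differ by O(1/N). *)
Lemma krylov_bogoliubov (x0 : X) (F : set_system nat) :
  K x0 -> ProperFilter F -> \oo `<=` F ->
  exists mu : probability (Borel X) R, [/\ mu K = 1%E,
    forall A : set (Borel X), measurable A -> evolve mu A = mu A &
    forall O c, open O ->
      (\forall N \near F,
         N.+1%:R^-1 * \sum_(t < N.+1) fine (transition t.+1 x0 O) <= c) ->
      (mu O <= c%:E)%E].
Proof.
move=> Kx0 PF ooF; have [U [UU FU]] := ultraFilterLemma PF.
(* Laws of the chain from time 1 on: weak polarization leaves time 0 out of its averages. *)
pose law t := iter t.+1 evolve (dirac (x0 : Borel X)).
have mK := closed_Borel_measurable closedK.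
have lawK t : law t K = 1%E.
  elim: t => [|t ih]; apply: evolve_full => //.
  by rewrite /= diracE mem_set.
have cesaroK N : cesaro law N K = 1%E.
  rewrite -[LHS]fineK ?fin_num_measure// fine_cesaro//.
  by under eq_bigr do rewrite lawK/=; rewrite sumr_const card_ord mulVf.
have [mu [muK mu_cvg mu_le]] := ultralimit UU compactK closedK cesaroK.
exists mu; split=> //; last first.
  move=> O c oO HO; apply: mu_le => //; apply: FU; apply: filterS HO => N.
  rewrite fine_cesaro//; last exact: open_Borel_measurable.
  by under eq_bigr do rewrite (transition_iter_evolve _ _ (open_Borel_measurable oO)).
apply: probability_eq_continuous => h ch th; rewrite Rintegral_evolve//.
have tPh := test_fun_markov_op th.
have cPh := markov_op_continuous ch th.
have PU := @ultra_proper _ _ UU; have fU : Filter U by exact: filter_filter.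
have ch' : {within K, continuous (h : X -> R)} by exact: continuous_subspaceT.
have dcvg := cvgB (mu_cvg _ tPh cPh) (mu_cvg _ th ch').
have d0 : (fun N => \int[cesaro law N]_x markov_op h x - \int[cesaro law N]_x h x)
    @ U --> (0 : R).
  (* The difference tends to 0 along all large [N], hence along the finer [U], where it also tends
     to the difference of the integrals against [mu]. *)
  apply: (@cvg_trans _ ((fun N =>
    \int[cesaro law N]_x markov_op h x - \int[cesaro law N]_x h x) @ \oo)).
    by apply: cvg_app => A /ooF /FU.
  apply/cvgr0Pnorm_lt => e e0; near=> N.
  rewrite !Rintegral_cesaro// -mulrBr -sumrB.
  (* By duality [markov_op] turns the integral against [law k] into one against [law k.+1], so the
     sum telescopes to two integrals with values between 0 and 1. *)
  under eq_bigr do rewrite -Rintegral_evolve//.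
  rewrite -(big_mkord xpredT (fun k => \int[law k.+1]_x h x - \int[law k]_x h x)).
  rewrite telescope_sumr//= normrM gtr0_norm ?invr_gt0//.
  apply: (@le_lt_trans _ _ N.+1%:R^-1); last first.
    by near: N; exact: (near_infty_natSinv_lt (PosNum e0)).
  rewrite ler_piMr// ler_norml.
  have /andP[a0 a1] := Rintegral_test_fun01 (law N.+1) th.
  have /andP[b0 b1] := Rintegral_test_fun01 (law 0%N) th.
  apply/andP; split; first by rewrite lerBrDr (le_trans _ a0)// addrC subr_le0.
  by rewrite lerBlDr (le_trans a1)// lerDl.
apply/eqP; rewrite -subr_eq0 -(cvg_lim (@Rhausdorff R) (dcvg fU)); apply/eqP.
by apply: cvg_lim => //; exact: Rhausdorff.
Unshelve. all: by end_near. Qed.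

End markov_chain.

(** * Lower integrals and Borel matrices *)

Section integral_full.
Context {d} {T : measurableType d} {R : realType} (mu : {measure set T -> \bar R}).
Import HBNNSimple.

(* No measurability of [g]: the integral of a nonnegative function is a
   supremum over the simple functions below it. *)
Lemma ge0_integral_full (E : set T) (g : T -> \bar R) :
  measurable E -> mu (~` E) = 0%E -> (forall x, 0 <= g x)%E ->
  (\int[mu]_x g x = \int[mu]_(x in E) g x)%E.
Proof.
move=> mE E0 g0; apply/eqP; rewrite eq_le; apply/andP; split.
  rewrite ge0_integralTE//; apply: ge_ereal_sup => _ [h /= hg <-].
  rewrite -integralT_nnsfun (@ge0_negligible_integral _ _ _ _ _ (~` E))//.
  - rewrite setTD setCK integral_nnsfun// mrestrict ge0_integralE//.
    apply: ereal_sup_ubound; exists (proj_nnsfun h mE) => //= x.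
    rewrite mindicE /patch; case: ifP => _; rewrite ?mulr1 ?mulr0//; exact: hg.
  - exact: measurableC.
  - exact/measurable_EFinP.
  - by move=> x _; rewrite lee_fin.
rewrite ge0_integralE// ge0_integralTE//; apply: le_ereal_sup => _ [h /= hg <-].
exists h => // x; rewrite (le_trans (hg x))// /patch; case: ifP => // _.
Qed.

End integral_full.

HB.instance Definition _ (R : realType) m n := PseudoMetric.on 'M[R]_(m, n).

Section matrices.
Context {R : realType} {m n : nat}.

Lemma cvg_mx {I : Type} (F : set_system I) (f : I -> 'M[R]_(m, n)) (M : 'M[R]_(m, n)) :
  Filter F -> (forall i j, f k i j @[k --> F] --> M i j) -> f @ F --> M.
Proof.
move=> FF fM A [P MP PA].
have : \forall k \near F, forall ij : 'I_m * 'I_n, P ij.1 ij.2 (f k ij.1 ij.2).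
  by apply: filter_forall => -[i j]; apply: fM; exact: MP.
by apply: filterS => k Pk; apply: PA => i j; exact: (Pk (i, j)).
Qed.

Lemma continuous_mx {T : topologicalType} (f : T -> 'M[R]_(m, n)) :
  (forall i j, continuous (fun x => f x i j)) -> continuous f.
Proof. by move=> cf x; apply: cvg_mx => i j; exact: cf. Qed.

(** Second countability: the union ranges over countably many balls, so sigma-additivity can reach
    all open sets. *)
Lemma open_mx_rat (O : set 'M[R]_(m, n)) : open O ->
  O = \bigcup_(qk in [set qk : 'M[rat]_(m, n) * nat |
        ball (map_mx ratr qk.1 : 'M[R]_(m, n)) qk.2.+1%:R^-1 `<=` O])
      ball (map_mx ratr qk.1 : 'M[R]_(m, n)) qk.2.+1%:R^-1.
Proof.
rewrite openE => oO; apply/seteqP; split=> [x Ox|x [qk qkO] /qkO//].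
have /nbhs_ballP[e /= e0 eO] := oO _ Ox.
have [k ke] : exists k, k.+1%:R^-1 < e / 2 :> R.
  near \oo => k; exists k; near: k.
  by apply: (near_infty_natSinv_lt (PosNum _)); rewrite divr_gt0.
pose r : R := k.+1%:R^-1; have r0 : 0 < r by rewrite invr_gt0.
have /choice[q Hq] : forall ij : 'I_m * 'I_n, exists q : rat,
    `|x ij.1 ij.2 - ratr q| < r.
  move=> [i j] /=; have [|q] := @rat_in_itvoo R (x i j) (x i j + r).
    by rewrite ltrDl.
  rewrite in_itv/= => /andP[xq qx]; exists q.
  by rewrite ltr0_norm ?subr_lt0// opprB ltrBlDl.
exists (\matrix_(i, j) q (i, j), k) => /=.
  move=> y [_ qy]; apply: eO; split=> // i j; rewrite (splitr e).
  apply: (@ball_triangle _ _ (ratr (q (i, j)) : R)).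
    by rewrite /ball/= (lt_trans (Hq (i, j))).
  by have := qy i j; rewrite !mxE; apply: le_ball; exact: ltW.
by split=> // i j; rewrite !mxE /ball/= distrC; exact: (Hq (i, j)).
Unshelve. all: by end_near. Qed.

(** A ball of matrices is a finite intersection of conditions on the coordinates, and by
    [open_mx_rat] such balls generate the Borel sets. *)
Lemma measurable_fun_mx {d} {T : measurableType d} (E : set T)
    (f : T -> Borel 'M[R]_(m, n)) :
  (forall i j, measurable_fun E (fun x => (f x : 'M[R]_(m, n)) i j)) -> measurable_fun E f.
Proof.
move=> mf mE; move: (mE).
apply: (@measurability _ _ _ (Borel 'M[R]_(m, n)) _ _ (@open _)) => //.
move=> _ [U oU <-]; rewrite (open_mx_rat oU) preimage_bigcup setI_bigcupr bigcup_mkcond.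
apply: countable_bigcupT_measurable => [|[q k]]; first exact: countableP.
case: ifP => // _.
rewrite (_ : _ `&` _ = E `&` \bigcap_(ij in [set: 'I_m * 'I_n])
    (E `&` [set x | ball (ratr (q ij.1 ij.2) : R) k.+1%:R^-1
      ((f x : 'M[R]_(m, n)) ij.1 ij.2)])).
  apply: measurableI => //; apply: fin_bigcap_measurable => // -[i j] _.
  by apply: mf => //; apply: open_measurable; exact: ball_open.
apply/seteqP; split=> x.
  by move=> [Ex [_ qx]]; split=> // -[i j] _; split=> //=; have := qx i j; rewrite mxE.
move=> [Ex fx]; split=> //; split=> // i j.
by have [_] := fx (i, j) I; rewrite mxE.
Qed.

Lemma compact_mx_itv (r : R) :
  compact [set M : 'M[R]_(m, n) | forall i j, `|M i j| <= r].
Proof.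
have cv : continuous (vec_mx : 'rV[R]_(m * n) -> 'M[R]_(m, n)).
  apply: continuous_mx => i j; under eq_fun do rewrite mxE.
  exact: coord_continuous.
have := @rV_compact R (m * n) (fun=> `[-r, r]%classic) (fun=> @segment_compact _ _ _).
move=> /(continuous_compact (continuous_subspaceT cv)).
congr compact; apply/seteqP; split.
  move=> _ [v /= vr <-] i j; rewrite mxE ler_norml.
  by have := vr (mxvec_index i j); rewrite in_itv.
move=> M Mr; exists (mxvec M); last by rewrite mxvecK.
move=> k /=; have [i j] := mxvec_indexP k.
by rewrite mxvecE in_itv/= -ler_norml.
Qed.

End matrices.

(** * Spheres and polarized configurations *)

Section sphere.
Context {R : realType}.

Lemma enorm_gt0 d (v : 'rV[R]_d) : v != 0 -> 0 < enorm v.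
Proof.
move=> v0; rewrite lt_neqAle sqrtr_ge0 andbT eq_sym; apply: contra v0; rewrite sqrtr_eq0 => v0.
have /psumr_eq0P v2 : \sum_(j < d) v 0 j ^+ 2 = 0.
  by apply/eqP; rewrite eq_le v0 sumr_ge0// => j _; exact: sqr_ge0.
apply/eqP/rowP => j; rewrite mxE; apply/eqP; rewrite -sqrf_eq0.
by rewrite v2// => k _; exact: sqr_ge0.
Qed.

Lemma sph_proj_sph d (v : 'rV[R]_d) : v != 0 -> sph (proj_sph v).
Proof.
move=> v0; have e0 := enorm_gt0 v0; rewrite /sph/=.
under eq_bigr do rewrite mxE exprMn; rewrite -mulr_sumr.
have -> : \sum_(j < d) v 0 j ^+ 2 = enorm v ^+ 2.
  by rewrite sqr_sqrtr// sumr_ge0// => j _; exact: sqr_ge0.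
by rewrite -exprMn mulVf ?gt_eqF// expr1n.
Qed.

Lemma sphnE n d (x : 'M[R]_(n, d)) :
  sphn x <-> forall i, \sum_(j < d) x i j ^+ 2 = 1.
Proof.
have E i : sph (row i x) = (\sum_(j < d) x i j ^+ 2 = 1).
  by rewrite /sph/=; under eq_bigr do rewrite mxE.
by split=> + i => /(_ i); rewrite E.
Qed.

Lemma cvg_sum_sqr n d {I : Type} (F : set_system I) (g : I -> 'M[R]_(n, d))
    (M : 'M[R]_(n, d)) i :
  Filter F -> (forall j, g k i j @[k --> F] --> M i j) ->
  \sum_(j < d) g k i j ^+ 2 @[k --> F] --> \sum_(j < d) M i j ^+ 2.
Proof.
move=> FF gM; apply: (cvg_big (@add_continuous _)) => j _.
by under eq_fun do rewrite expr2; rewrite expr2; apply: cvgM; exact: gM.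
Qed.

Lemma continuous_sum_sqr n d i :
  continuous (fun M : 'M[R]_(n, d) => \sum_(j < d) M i j ^+ 2).
Proof.
move=> M; apply: (@cvg_sum_sqr _ _ _ (nbhs M)) => j.
exact: coord_continuous.
Qed.

Lemma closed_eq_fun {T : topologicalType} (f g : T -> R) :
  continuous f -> continuous g -> closed [set x | f x = g x].
Proof.
move=> cf cg; rewrite (_ : mkset _ = (fun x => f x - g x) @^-1` [set 0]).
  have /continuous_closedP : continuous (fun x => f x - g x).
    by move=> x; apply: cvgB; [exact: cf|exact: cg].
  by apply; exact: closed_eq.
apply/seteqP; split=> x /=; first by move=> ->; rewrite subrr.
by move=> /eqP; rewrite subr_eq0 => /eqP.
Qed.

Lemma closed_sph d : closed (@sph R d).
Proof.
by apply: closed_eq_fun; [exact: (@continuous_sum_sqr 1 d 0)|exact: cst_continuous].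
Qed.

Lemma closed_sphn n d : closed (@sphn R n d).
Proof.
rewrite (_ : @sphn R n d = \bigcap_i [set x : 'M[R]_(n, d) | \sum_(j < d) x i j ^+ 2 = 1]).
  apply: closed_bigI => i _.
  by apply: closed_eq_fun; [exact: continuous_sum_sqr|exact: cst_continuous].
by apply/seteqP; split=> x;
  [move/sphnE => + i _; exact|move=> xi; apply/sphnE => i; exact: xi].
Qed.

Lemma sphn_le1 n d (x : 'M[R]_(n, d)) i j : sphn x -> `|x i j| <= 1.
Proof.
move=> /sphnE/(_ i); rewrite (bigD1 j)//= => x1.
rewrite -(@ler_pXn2r _ 2)// ?nnegrE// expr1n real_normK ?num_real// -x1 lerDl.
by rewrite sumr_ge0// => k _; exact: sqr_ge0.
Qed.

Lemma compact_sphn n d : compact (@sphn R n d).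
Proof.
apply: (subclosed_compact (@closed_sphn n d) (@compact_mx_itv R n d 1)).
by move=> x Kx i j; exact: sphn_le1.
Qed.

End sphere.

(** * The polarized set and the distance to it *)

Section polarized.
Context {R : realType} {n d : nat}.
Hypotheses (hn : (0 < n)%N) (hd : (0 < d)%N).

Lemma Ppol_sphn : @Ppol R n d `<=` @sphn R n d.
Proof.
move=> _ [v [v1 [s ->]]]; apply/sphnE => i; rewrite -[RHS]v1.
by apply: eq_bigr => j _; rewrite !mxE exprMn sqrr_sign mul1r.
Qed.

Lemma Ppol_nonempty : @Ppol R n d !=set0.
Proof.
exists (\matrix_(i, j) ((-1) ^+ (fun=> false) i * (delta_mx 0 (Ordinal hd) : 'rV[R]_d) 0 j)).
exists (delta_mx 0 (Ordinal hd)); split; last by exists (fun=> false).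
rewrite /sph/= (bigD1 (Ordinal hd))//= mxE !eqxx expr1n big1 ?addr0// => j jd.
by rewrite mxE (negbTE jd) andbF expr0n.
Qed.

(** Agent 0 serves as the reference direction [v], which removes the existential quantifiers and
    leaves closed conditions on the coordinates. *)
Lemma PpolE : @Ppol R n d = @sphn R n d `&`
  \bigcap_i ([set z | forall j, z i j = z (Ordinal hn) j] `|`
             [set z | forall j, z i j = - z (Ordinal hn) j]).
Proof.
apply/seteqP; split=> z.
  move=> Pz; split; first exact: Ppol_sphn.
  have [v [v1 [s ->]]] := Pz; move=> i _.
  have [ss|/negbTE ss] := eqVneq (s i) (s (Ordinal hn)); [left|right] => j.
    by rewrite !mxE ss.
  by rewrite !mxE; move: ss; do 2 case: (s _); rewrite //= ?expr0 ?expr1 ?mulN1r ?mul1r ?opprK.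
move=> [/sphnE z1 zP]; exists (row (Ordinal hn) z); split.
  by rewrite /sph/=; under eq_bigr do rewrite mxE; exact: z1.
exists (fun i => ~~ `[< forall j, z i j = z (Ordinal hn) j >]).
apply/matrixP => i j; rewrite !mxE; case: asboolP => [->|nz] /=.
  by rewrite expr0 mul1r.
by rewrite expr1 mulN1r; have [] := zP i I.
Qed.

Lemma closed_Ppol : closed (@Ppol R n d).
Proof.
rewrite PpolE; apply: closedI; first exact: closed_sphn.
have cN i j : continuous (fun z : 'M[R]_(n, d) => - z i j).
  by move=> z; exact: cvgN (@coord_continuous R n d i j z).
have cE (i : 'I_n) (g : 'I_d -> 'M[R]_(n, d) -> R) : (forall j, continuous (g j)) ->
    closed [set z : 'M[R]_(n, d) | forall j, z i j = g j z].
  move=> cg.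
  have := @closed_bigI _ _ setT (fun j => [set z : 'M[R]_(n, d) | z i j = g j z])
    (fun j _ => closed_eq_fun (@coord_continuous R n d i j) (cg j)).
  by congr closed; apply/seteqP; split=> z zE j; [|move=> _]; apply: zE.
apply: closed_bigI => i _; apply: closedU; first by apply: cE => j; exact: coord_continuous.
by apply: (cE i (fun j z => - z (Ordinal hn) j)).
Qed.

Lemma config_dist_ge0 (z y : 'M[R]_(n, d)) : 0 <= Defs.edist z y.
Proof. exact: sqrtr_ge0. Qed.

Lemma cvg_config_dist {I : Type} (F : set_system I) (g : I -> 'M[R]_(n, d))
    (M y : 'M[R]_(n, d)) :
  Filter F -> (forall i j, g k i j @[k --> F] --> M i j) ->
  Defs.edist (g k) y @[k --> F] --> Defs.edist M y.
Proof.
move=> FF gM; apply: continuous_cvg; first exact: sqrt_continuous.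
apply: (cvg_big (@add_continuous _)) => i _.
apply: (cvg_big (@add_continuous _)) => j _.
under eq_fun do rewrite expr2; rewrite expr2.
by apply: cvgM; (apply: cvgB; [exact: gM|exact: cvg_cst]).
Qed.

Lemma continuous_config_dist (y : 'M[R]_(n, d)) : continuous (fun z => Defs.edist z y).
Proof.
move=> z; apply: (@cvg_config_dist _ (nbhs z) id) => i j.
exact: coord_continuous.
Qed.

Lemma coord_le_config_dist (z y : 'M[R]_(n, d)) i j : `|z i j - y i j| <= Defs.edist z y.
Proof.
rewrite -sqrtr_sqr ler_wsqrtr// (bigD1 i)//= (bigD1 j)//= -addrA lerDl.
by rewrite addr_ge0// sumr_ge0// => k _; rewrite ?sqr_ge0// sumr_ge0// => l _; exact: sqr_ge0.
Qed.

(** An infimum of continuous functions is upper semicontinuous: as a union, the strict sublevel set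
    is visibly open. *)
Lemma rhoP_ltE (c : R) : [set z : 'M[R]_(n, d) | rhoP z < c] =
  \bigcup_(y in @Ppol R n d) [set z | Defs.edist z y < c].
Proof.
(* Nonemptiness matters because [inf] of the empty set is 0 by convention. *)
have [y0 Py0] := Ppol_nonempty.
apply/seteqP; split=> z /=.
  move=> /inf_lt[|_ [y Py <-] zy]; last by exists y.
  by exists (Defs.edist z y0), y0.
move=> [y Py /=]; apply: le_lt_trans; apply: ge_inf; last by exists y.
by exists 0 => _ [x _ <-]; exact: config_dist_ge0.
Qed.

Lemma open_rhoP_lt (c : R) : open [set z : 'M[R]_(n, d) | rhoP z < c].
Proof.
rewrite rhoP_ltE; apply: bigcup_open => y _.
have /continuousP/(_ [set x | x < c]) := @continuous_config_dist y.
by apply; exact: open_lt.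
Qed.

Lemma measurable_Peps (c : R) : measurable (Peps c : set (Borel 'M[R]_(n, d))).
Proof.
rewrite (_ : Peps c = \bigcap_k [set z | rhoP z < c + k.+1%:R^-1]).
  apply: bigcapT_measurable => k.
  exact: (open_Borel_measurable (@open_rhoP_lt _)).
apply/seteqP; split=> z /=.
  by move=> zc k _ /=; rewrite (le_lt_trans zc)// ltrDl invr_gt0.
move=> zc; apply/ler_addgt0Pr => e e0; near \oo => k.
rewrite (le_trans (ltW (zc k I)))// lerD2l ltW//; near: k.
exact: (near_infty_natSinv_lt (PosNum e0)).
Unshelve. all: by end_near. Qed.

Lemma Ppol_rhoP_lt (c : R) : 0 < c -> @Ppol R n d `<=` [set z | rhoP z < c].
Proof.
move=> c0 z Pz; rewrite rhoP_ltE; exists z => //=.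
by rewrite /Defs.edist big1 ?sqrtr0// => i _; rewrite big1// => j _; rewrite subrr expr0n.
Qed.

(** Closedness of P yields a ball in the coordinatewise metric, whereas [rhoP] is Euclidean;
    [coord_le_config_dist] links the two. *)
Lemma bigcap_Peps : \bigcap_k Peps k.+1%:R^-1 `<=` @Ppol R n d.
Proof.
move=> z Hz; apply: contrapT => nPz.
have : nbhs z (~` @Ppol R n d).
  by apply: open_nbhs_nbhs; split => //; exact/closed_openC/closed_Ppol.
move=> /nbhs_ballP[e /= e0 eP].
have : e <= rhoP z.
  apply: lb_le_inf; first by have [y Py] := Ppol_nonempty; exists (Defs.edist z y), y.
  move=> _ [y Py <-]; rewrite leNgt; apply/negP => zye.
  apply: (eP y) Py; split=> // i j; rewrite /ball/=.
  exact: le_lt_trans (coord_le_config_dist z y i j) zye.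
apply/negP; rewrite -ltNge; near \oo => k.
apply: le_lt_trans (Hz k I) _; near: k.
exact: (near_infty_natSinv_lt (PosNum e0)).
Unshelve. all: by end_near. Qed.

End polarized.

Section transition_facts.
Context {R : realType} {X : pseudoPMetricType R} {dY} {Y : measurableType dY}.
Variables (D : probability Y R) (S : {mfun (Borel X * Y)%type >-> Borel X}).

Lemma fine_transitionK t x (A : set (Borel X)) : measurable A ->
  (fine (transition D S t x A))%:E = transition D S t x A.
Proof. by move=> mA; rewrite transition_iter_evolve// fineK// fin_num_measure. Qed.

Lemma test_fun_transition t (A : set (Borel X)) : measurable A ->
  test_fun (fun x : Borel X => fine (transition D S t x A)).
Proof.
move=> mA; split=> [|x].
  by apply: (@measurableT_comp _ _ _ _ _ _ fine) => //; exact: measurable_transition.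
rewrite -!lee_fin fine_transitionK// transition_ge0.
by rewrite transition_iter_evolve// probability_le1.
Qed.

Lemma le_transition t x (A B : set (Borel X)) : measurable A -> measurable B ->
  A `<=` B -> fine (transition D S t x A) <= fine (transition D S t x B).
Proof.
move=> mA mB AB; rewrite -lee_fin !fine_transitionK// !transition_iter_evolve//.
by apply: le_measure; rewrite ?inE.
Qed.

(** Invariance is an equality on measurable sets, not of bundled measures, so it cannot be rewritten
    under [evolve]; both sides are turned into integrals of the one-step transition, where the
    measure can be exchanged. *)
Lemma iter_evolve_invariant (mu : probability (Borel X) R) t :
  (forall A : set (Borel X), measurable A -> evolve D S mu A = mu A) ->
  forall A : set (Borel X), measurable A -> iter t (evolve D S) mu A = mu A.
Proof.
move=> inv; elim: t => [//|t ih] A mA; rewrite iterS -[RHS]inv//.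
rewrite -(@integral_transition _ _ _ _ D S (iter t (evolve D S) mu) 1)//.
rewrite -(@integral_transition _ _ _ _ D S mu 1)//.
by apply: eq_measure_integral => B mB _; exact: ih.
Qed.

End transition_facts.

(** * Time averages of transition probabilities *)

Section cesaro_transition.
Context {R : realType} {X : pseudoPMetricType R} {dY} {Y : measurableType dY}.
Variables (D : probability Y R) (S : {mfun (Borel X * Y)%type >-> Borel X}).

Definition cesaro_transition N (x : X) (A : set X) : R :=
  N.+1%:R^-1 * \sum_(t < N.+1) fine (transition D S t.+1 x A).

Lemma test_fun_cesaro_transition N (A : set (Borel X)) : measurable A ->
  test_fun (cesaro_transition N ^~ A : Borel X -> R).
Proof.
move=> mA; have tA t := test_fun_transition D S t mA; split=> [|x].
  apply: measurable_funM; first exact: measurable_cst.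
  by apply: measurable_sum => t; have [] := tA t.+1.
rewrite /cesaro_transition mulr_ge0//=; last first.
  by apply: sumr_ge0 => t _; have [_ /(_ x)/andP[]] := tA t.+1.
rewrite ler_pdivrMl// mulr1 (@le_trans _ _ (\sum_(t < N.+1) 1))//.
  by apply: ler_sum => t _; have [_ /(_ x)/andP[]] := tA t.+1.
by rewrite sumr_const card_ord.
Qed.

Lemma Rintegral_cesaro_transition N (mu : probability (Borel X) R) (A : set (Borel X)) :
  (forall B : set (Borel X), measurable B -> evolve D S mu B = mu B) ->
  measurable A -> \int[mu]_x cesaro_transition N x A = fine (mu A).
Proof.
move=> inv mA; have tA t := test_fun_transition D S t mA.
have [iS ES] := @Rintegral_sum _ _ _ mu N.+1
  (fun t x => fine (transition D S t.+1 x A)) (fun t => test_fun_integrable mu (tA t.+1)).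
rewrite RintegralZl// ES (eq_bigr (fun=> fine (mu A))).
  by rewrite sumr_const card_ord -(mulr_natl (fine (mu A))) mulrA mulVf// mul1r.
move=> t _; rewrite /Rintegral; under eq_integral do rewrite fine_transitionK//.
by rewrite integral_transition// iter_evolve_invariant.
Qed.

(* Dominated convergence, the Cesaro averages of an invariant measure being
   constant. *)
Lemma invariant_cesaro_full (mu : probability (Borel X) R) (K A : set (Borel X)) :
  (forall B : set (Borel X), measurable B -> evolve D S mu B = mu B) ->
  measurable K -> measurable A -> mu K = 1%E ->
  (forall x, K x -> cesaro_transition N x A @[N --> \oo] --> (1 : R)) ->
  mu A = 1%E.
Proof.
move=> inv mK mA muK cvgA.
have tA N := test_fun_cesaro_transition N mA.
have muK0 : mu (~` K) = 0%E by rewrite [LHS](probability_setC mu mK) muK subee.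
(* The integral is restricted to [K] because pointwise convergence is assumed only there. *)
have intA N : (\int[mu]_(x in K) (cesaro_transition N x A)%:E = mu A)%E.
  rewrite -(ge0_integral_full mK muK0); last first.
    by move=> x; rewrite lee_fin; have /andP[] := (tA N).2 x.
  rewrite -[LHS]fineK; last exact/integrable_fin_num/test_fun_integrable.
  by rewrite [fine _](Rintegral_cesaro_transition N inv mA) fineK// fin_num_measure.
have : (\int[mu]_(x in K) (cesaro_transition N x A)%:E @[N --> \oo] -->
    \int[mu]_(x in K) cst 1 x)%E.
  apply: (@dominated_cvg _ _ _ mu K mK _ _ (cst 1%E)).
  - by move=> N; apply/measurable_EFinP; apply: measurable_funTS; exact: (tA N).1.
  - by move=> x Kx; apply: cvg_EFin; [exact: nearW|exact: cvgA].
  - by [].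
  - apply: (@integrableS _ _ _ mu setT) => //.
    exact: (finite_measure_integrable_cst mu 1).
  - move=> N x _; have /andP[a0 a1] := (tA N).2 x.
    by rewrite /= lee_fin ger0_norm.
under eq_fun do rewrite intA.
have -> : (\int[mu]_(x in K) cst 1 x = 1)%E by rewrite integral_cst// mul1e; exact: muK.
move=> /(cvg_lim (@ereal_hausdorff R)) <-.
by apply/esym/cvg_lim; [exact: ereal_hausdorff|exact: cvg_cst].
Qed.

End cesaro_transition.

(** * Geometric opinion dynamics *)

Section dynamics.
Context {R : realType} {n d : nat}.
Variables (f : 'I_n -> 'M[R]_(n, d) -> 'rV[R]_d -> 'rV[R]_d)
  (D : probability (Borel 'rV[R]_d) R).
Hypothesis hD : D (@sph R d) = 1%E.
Hypothesis hf_meas : forall i : 'I_n,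
  measurable_fun
    ((@sphn R n d `*` @sph R d) : set (Borel 'M[R]_(n, d) * Borel 'rV[R]_d)%type)
    (fun p : (Borel 'M[R]_(n, d) * Borel 'rV[R]_d)%type =>
       (f i p.1 p.2 : Borel 'rV[R]_d)).
Hypothesis hf_nz : forall (i : 'I_n) (x : 'M[R]_(n, d)) (xi : 'rV[R]_d),
  @sphn R n d x -> @sph R d xi -> row i x + f i x xi != 0.

Let E : set (Borel 'M[R]_(n, d) * Borel 'rV[R]_d)%type := @sphn R n d `*` @sph R d.

Let msph : measurable (@sph R d : set (Borel 'rV[R]_d)).
Proof. exact: closed_Borel_measurable (@closed_sph R d). Qed.

Let msphn : measurable (@sphn R n d : set (Borel 'M[R]_(n, d))).
Proof. exact: closed_Borel_measurable (@closed_sphn R n d). Qed.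

Let mE : measurable E. Proof. exact: measurableX. Qed.

Let stepE x xi i j : step f x xi i j =
  (enorm (row i x + f i x xi))^-1 * (row i x + f i x xi) 0 j.
Proof. by rewrite !mxE. Qed.

Lemma measurable_step : measurable_fun E
  (fun p : (Borel 'M[R]_(n, d) * Borel 'rV[R]_d)%type => step f p.1 p.2 : Borel 'M[R]_(n, d)).
Proof.
apply: measurable_fun_mx => i j; under eq_fun do rewrite stepE.
pose v (p : Borel 'M[R]_(n, d) * Borel 'rV[R]_d) : 'rV[R]_d := row i p.1 + f i p.1 p.2.
have mv k : measurable_fun E (fun p => v p 0 k).
  rewrite (_ : (fun p => _) = (fun p => (p.1 : 'M[R]_(n, d)) i k + f i p.1 p.2 0 k)).
    apply: measurable_funD.
      apply: measurable_funTS.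
      exact: (measurableT_comp (continuous_Borel_measurable
        (@coord_continuous R n d i k)) measurable_fst).
    exact: (measurableT_comp (continuous_Borel_measurable
      (@coord_continuous R 1 d 0 k)) (hf_meas i)).
  by apply/funext => p; rewrite !mxE.
apply: measurable_funM; last exact: mv.
(* Real powers are measurable on the whole line, and the power -1 agrees with the inverse on
   nonnegative numbers, both being 0 at 0. *)
rewrite (_ : (fun p => _) = (fun p => enorm (v p) `^ (-1))).
  apply: (measurableT_comp (measurable_powR (-1))).
  have ms : measurable_fun E (fun p => \sum_(k < d) v p 0 k ^+ 2).
    by apply: measurable_sum => k; apply: measurable_funX; exact: mv.
  exact: (measurableT_comp (continuous_measurable_fun (@sqrt_continuous R)) ms).
by apply/funext => p; rewrite powR_inv1// sqrtr_ge0.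
Qed.

(* [f] is controlled only on the spheres, so the update map is replaced by the
   identity off them to get an everywhere measurable map. *)
Definition total_step (p : Borel 'M[R]_(n, d) * Borel 'rV[R]_d) : Borel 'M[R]_(n, d) :=
  if p \in E then step f p.1 p.2 else p.1.

Lemma measurable_total_step : measurable_fun setT total_step.
Proof.
move=> _ B mB; rewrite (_ : _ `&` _ =
  (E `&` (fun p => step f p.1 p.2) @^-1` B) `|` (~` E `&` fst @^-1` B)).
  apply: measurableU; first exact: measurable_step.
  apply: measurableI; first exact: measurableC.
  by rewrite -[X in measurable X]setTI; exact: measurable_fst.
rewrite setTI; apply/seteqP; split=> p; rewrite /total_step /=.
  have [pE|pE] := boolP (p \in E) => Bp; [left|right]; split=> //; first exact/set_mem.
  by rewrite notin_setE in pE.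
by move=> [[pE Bp]|[pE Bp]]; [rewrite mem_set|rewrite memNset].
Qed.

HB.instance Definition _ :=
  isMeasurableFun.Build _ _ _ _ total_step measurable_total_step.

Lemma total_step_on x xi : sphn x -> sph xi -> total_step (x, xi) = step f x xi.
Proof. by move=> Kx Kxi; rewrite /total_step mem_set. Qed.

Lemma step_sphn x xi : sphn x -> sph xi -> sphn (step f x xi).
Proof.
move=> Kx Kxi; apply/sphnE => i; rewrite -[RHS](sph_proj_sph (hf_nz i Kx Kxi)).
by apply: eq_bigr => j _; rewrite !mxE.
Qed.

Lemma total_step_sphn x xi : sphn x -> sphn (total_step (x, xi)).
Proof.
move=> Kx; rewrite /total_step; case: ifPn => // /set_mem[_ Kxi].
exact: step_sphn.
Qed.

Lemma step_continuous xi :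
  (forall i, {within @sphn R n d, continuous (fun x : 'M[R]_(n, d) => f i x xi)}) ->
  sph xi -> {within @sphn R n d, continuous (fun x => step f x xi)}.
Proof.
move=> cf Kxi; apply/subspace_continuousP => x Kx.
have FF : Filter (within (@sphn R n d) (nbhs x)) by exact: within_filter.
have cv i j : (row i y + f i y xi) 0 j @[y --> within (@sphn R n d) (nbhs x)]
    --> (row i x + f i x xi) 0 j.
  rewrite !mxE; under eq_fun do rewrite !mxE.
  apply: cvgD.
    apply: cvg_trans (@coord_continuous R n d i j x).
    by apply: cvg_app; exact: cvg_within.
  have /subspace_continuousP/(_ x Kx) := cf i.
  move=> fi; exact: (@continuous_cvg _ _ _ _ FF _
    (fun M : 'rV[R]_d => M 0 j) _ (@coord_continuous R 1 d 0 j _) fi).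
apply: cvg_mx => i j; rewrite stepE; under eq_fun do rewrite stepE.
apply: cvgM; last exact: cv.
apply: cvgV; first by rewrite gt_eqF// enorm_gt0// hf_nz.
exact: (@continuous_cvg _ _ _ _ FF _ Num.sqrt _ (@sqrt_continuous R _)
  (cvg_sum_sqr FF (cv i))).
Qed.

(** The fallback in [total_step] is the identity because it is continuous and preserves [sphn], so
    the hypotheses on the chain hold for every noise value, on the sphere or not. *)
Lemma total_step_continuous :
  (forall (xi : 'rV[R]_d) (i : 'I_n), @sph R d xi ->
      {within @sphn R n d, continuous (fun x : 'M[R]_(n, d) => f i x xi)}) ->
  forall xi, {within @sphn R n d,
    continuous (fun x : 'M[R]_(n, d) => total_step (x, xi) : 'M[R]_(n, d))}.
Proof.
move=> cf xi; have [Kxi|nKxi] := pselect (sph xi).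
  have := step_continuous (fun i => cf xi i Kxi) Kxi.
  apply: subspace_eq_continuous => x /set_mem Kx.
  by rewrite /from_subspace total_step_on.
rewrite (_ : (fun x => _) = id); first by apply: continuous_subspaceT => x.
by apply/funext => x; rewrite /total_step memNset// => -[_].
Qed.

Lemma ptrans_ge0 t x A : (0 <= ptrans f D t x A)%E.
Proof.
elim: t x => [|t ih] x /=; first by rewrite lee_fin.
by apply: integral_ge0 => xi _; exact: ih.
Qed.

(** Off the sphere [ptrans] may be a non-measurable integrand, so both integrals are first cut down
    to the full-measure sphere by [ge0_integral_full]; there the integrands agree, as [step] stays
    in [sphn]. *)
Lemma ptransE t x A : sphn x -> ptrans f D t x A = transition D total_step t x A.
Proof.
have D0 : D (~` @sph R d) = 0%E by rewrite [LHS](probability_setC D msph) hD subee.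
elim: t x => [//|t ih] x Kx /=.
rewrite (ge0_integral_full msph D0); last by move=> xi; exact: ptrans_ge0.
rewrite [RHS](ge0_integral_full msph D0); last by move=> xi; exact: transition_ge0.
apply: eq_integral => xi /set_mem Kxi.
by rewrite total_step_on// ih//; exact: step_sphn.
Qed.

Lemma invariant_distrE (mu : probability (Borel 'M[R]_(n, d)) R) :
  invariant_distr f D mu <-> mu (@sphn R n d) = 1%E /\
    forall A : set (Borel 'M[R]_(n, d)), measurable A -> evolve D total_step mu A = mu A.
Proof.
have E1 : mu (@sphn R n d) = 1%E -> forall A : set (Borel 'M[R]_(n, d)), measurable A ->
    (\int[mu]_x ptrans f D 1 x A)%E = evolve D total_step mu A.
  move=> muK A mA; rewrite -(@integral_transition _ _ _ _ D total_step mu 1)//.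
  have mu0 : mu (~` @sphn R n d) = 0%E by rewrite [LHS](probability_setC mu msphn) muK subee.
  rewrite (ge0_integral_full msphn mu0); last by move=> x; exact: ptrans_ge0.
  rewrite [RHS](ge0_integral_full msphn mu0); last by move=> x; exact: transition_ge0.
  by apply: eq_integral => x /set_mem Kx; exact: ptransE.
split=> -[muK inv]; split=> // A mA; first by rewrite -E1// inv.
by rewrite E1// inv.
Qed.

Let average x0 eps T := (T.+1%:R)^-1 *
        \sum_(t < T.+1) fine (ptrans f D t.+1 x0 (Peps eps)).

Hypotheses (hn : (0 < n)%N) (hd : (0 < d)%N).

Let averageE x0 eps T : sphn x0 ->
  average x0 eps T = cesaro_transition D total_step T x0 (Peps eps).
Proof.
by move=> Kx0; congr (_ * _); apply: eq_bigr => t _; rewrite ptransE.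
Qed.

Lemma invariant_measure_Ppol (mu : probability (Borel 'M[R]_(n, d)) R) :
  (forall x0, @sphn R n d x0 -> weakly_polarizes_on_average f D x0) ->
  invariant_distr f D mu -> mu (@Ppol R n d) = 1%E.
Proof.
move=> wp /invariant_distrE[muK inv].
have mP : measurable (@Ppol R n d : set (Borel 'M[R]_(n, d))).
  exact: closed_Borel_measurable (closed_Ppol hn).
have mPeps c := @measurable_Peps R n d hd c.
have mu1 (k : nat) : mu (Peps k.+1%:R^-1) = 1%E.
  apply: (invariant_cesaro_full inv _ (mPeps _) muK) => [|x Kx].
    exact: closed_Borel_measurable (@closed_sphn R n d).
  have := wp x Kx k.+1%:R^-1; rewrite invr_gt0 => /(_ (ltr0Sn _ _)).
  by under eq_fun do rewrite [_ * _]averageE//.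
have : mu (\bigcap_k Peps k.+1%:R^-1) = 1%E.
  have : mu \o (fun k => Peps k.+1%:R^-1) @ \oo --> mu (\bigcap_k Peps k.+1%:R^-1).
    apply: nonincreasing_cvg_mu => //.
    - by rewrite -ge0_fin_numE// fin_num_measure.
    - exact: bigcapT_measurable.
    - move=> k l kl; rewrite subsetEset => z; rewrite /Peps/= => /le_trans; apply.
      by rewrite lef_pV2 ?posrE// ler_nat ltnS.
  move=> /(cvg_lim (@ereal_hausdorff R)) <-.
  apply: cvg_lim; first exact: ereal_hausdorff.
  rewrite (_ : _ \o _ = cst 1%E); first exact: cvg_cst.
  by apply/funext => k; exact: mu1.
move=> muI; apply/eqP; rewrite eq_le probability_le1//= -muI.
apply: le_measure; rewrite ?inE//; first exact: bigcapT_measurable.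
exact: bigcap_Peps.
Qed.

Lemma weakly_polarizes_of_invariant (x0 : 'M[R]_(n, d)) :
  (forall (xi : 'rV[R]_d) (i : 'I_n), @sph R d xi ->
      {within @sphn R n d, continuous (fun x : 'M[R]_(n, d) => f i x xi)}) ->
  (forall mu : probability (Borel 'M[R]_(n, d)) R,
       invariant_distr f D mu -> mu (@Ppol R n d) = 1%E) ->
  sphn x0 -> weakly_polarizes_on_average f D x0.
Proof.
move=> cf invP Kx0 eps eps0; apply/cvgrPdist_lt => e e0; apply: contrapT => nlim.
have mPeps := @measurable_Peps R n d hd eps.
have mO := open_Borel_measurable (@open_rhoP_lt R n d hd eps).
(* Were this filter improper, the averages would eventually exceed [1 - e]; being at most 1, they
   would stay within [e] of 1, against [nlim]. *)
pose F := within [set T | average x0 eps T <= 1 - e] \oo.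
have PF : ProperFilter F.
  apply: Build_ProperFilter.
  move=> F0; apply: nlim.
  apply: (@filterS _ \oo _ [set T | average x0 eps T <= 1 - e -> False]) F0 => T /= nT.
  rewrite -/(average x0 eps T) ger0_norm.
    by rewrite ltrBlDr addrC -ltrBlDr ltNge; apply/negP.
  rewrite subr_ge0 averageE//.
  by have /andP[] := (test_fun_cesaro_transition D total_step T mPeps).2 x0.
have ooF : \oo `<=` F by move=> A; apply: filterS => T AT _.
have [mu [muK inv mu_le]] := krylov_bogoliubov D (S := total_step)
  (@compact_sphn R n d) (@closed_sphn R n d)
  (fun x xi => @total_step_sphn x xi) (total_step_continuous cf)
  Kx0 PF ooF.
have muP : mu (@Ppol R n d) = 1%E by apply/invP/invariant_distrE.
(* The bound is carried to [mu] only on open sets, hence the strict inequality; this smaller set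
   inherits the bound on the averages of [Peps eps]. *)
have : (mu [set z | (rhoP z < eps)%R] <= (1 - e)%:E)%E.
  apply: mu_le; first exact: open_rhoP_lt.
  apply: (@filterS _ _ _ [set T | average x0 eps T <= 1 - e]); last exact: withinT.
  move=> T /=; apply: le_trans; rewrite averageE// ler_wpM2l ?invr_ge0//.
  apply: ler_sum => t _; apply: (le_transition D total_step t.+1 x0 mO mPeps) => z.
  exact: ltW.
apply/negP; rewrite -ltNge (@lt_le_trans _ _ 1%E)//.
  by rewrite lte_fin ltrBlDr ltrDl.
rewrite -muP; apply: le_measure; rewrite ?inE//.
  exact: closed_Borel_measurable (closed_Ppol hn).
exact: Ppol_rhoP_lt.
Qed.

End dynamics.

Theorem theorem4p7 (R : realType) (n d : nat) (hn : (0 < n)%N) (hd : (0 < d)%N)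
  (f : 'I_n -> 'M[R]_(n, d) -> 'rV[R]_d -> 'rV[R]_d)
  (D : probability (Borel 'rV[R]_d) R)
  (hD : D (@sph R d) = 1%E)
  (hf_meas : forall i : 'I_n,
     measurable_fun
       ((@sphn R n d `*` @sph R d) : set (Borel 'M[R]_(n, d) * Borel 'rV[R]_d)%type)
       (fun p : (Borel 'M[R]_(n, d) * Borel 'rV[R]_d)%type =>
          (f i p.1 p.2 : Borel 'rV[R]_d)))
  (hf_nz : forall (i : 'I_n) (x : 'M[R]_(n, d)) (xi : 'rV[R]_d),
     @sphn R n d x -> @sph R d xi -> row i x + f i x xi != 0) :
  ((exists mu : probability (Borel 'M[R]_(n, d)) R,
      invariant_distr f D mu /\ (0 < mu (@sphn R n d `\` @Ppol R n d))%E) ->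
   exists x0, @sphn R n d x0 /\ ~ weakly_polarizes_on_average f D x0)
  /\
  ((forall (xi : 'rV[R]_d) (i : 'I_n), @sph R d xi ->
      {within @sphn R n d, continuous (fun x : 'M[R]_(n, d) => f i x xi)}) ->
   ((forall x0, @sphn R n d x0 -> weakly_polarizes_on_average f D x0) <->
    (forall mu : probability (Borel 'M[R]_(n, d)) R,
       invariant_distr f D mu -> mu (@Ppol R n d) = 1%E))).

Proof.
have mP : measurable (@Ppol R n d : set (Borel 'M[R]_(n, d))).
  exact: closed_Borel_measurable (closed_Ppol hn).
split; last first.
  move=> cf; split=> [wp mu inv|invP x0 Kx0].
    exact: (invariant_measure_Ppol hD hf_meas hf_nz hn hd wp inv).
  exact: (weakly_polarizes_of_invariant hD hf_meas hf_nz hn hd cf invP Kx0).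
(* By contraposition: if every start on [sphn] polarized, the invariant [mu] would have full mass on
   P and none on its complement. *)
move=> [mu [inv muPc]]; apply: contrapT => nx.
have muP : mu (@Ppol R n d) = 1%E.
  apply: (invariant_measure_Ppol hD hf_meas hf_nz hn hd _ inv) => x0 Kx0.
  by apply: contrapT => nwp; apply: nx; exists x0.
move: muPc; apply/negP; rewrite -leNgt.
rewrite -[leRHS](_ : mu (~` @Ppol R n d) = 0%E); last first.
  by rewrite [LHS](probability_setC mu mP) muP subee.
apply: le_measure; rewrite ?inE; last by move=> x [].
  apply: measurableD => //.
  exact: closed_Borel_measurable (@closed_sphn R n d).
exact: measurableC.
Qed.
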